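(* Let $\mathcal{F}:=(F_j)_{j\in\mathbb{N}}$ be a sequence of subsets of $\mathbb{R}^n$ satisfying the local scaling property (LSP) with respect to some $0\le\kappa<1$ and let $\Upsilon:=(\Upsilon_j)_{j\in\mathbb{N}}$ be a sequence of non-negative reals such that $\Upsilon_j\to0$ as $j\to\infty$. Let $s>\kappa n$ and suppose that for any ball $B$ in $\mathbb{R}^n$ we have $$\mathcal{H}^n\Big(B\cap\Lambda\big(\Upsilon^{\frac{s-\kappa n}{(1-\kappa)n}}\big)\Big)=\mathcal{H}^n(B).$$ Then, for any ball $B$ in $\mathbb{R}^n$ we have $$\mathcal{H}^s(B\cap\Lambda(\Upsilon))=\mathcal{H}^s(B).$$
   Context: $\mathcal{H}^s$ denotes $s$-dimensional Hausdorff measure on $\mathbb{R}^n$: $\mathcal{H}^s(F)=\lim_{\rho\to0}\inf\{\sum_i r(B_i)^s\}$, the infimum being over countable covers of $F$ by balls $B_i$ of radius $r(B_i)<\rho$. For $F\subset\mathbb{R}^n$ and $\delta\ge0$, $\Delta(F,\delta):=\{x\in\mathbb{R}^n:d(x,F)<\delta\}$, where $d(x,F)=\min\{d(x,y):y\in F\}$. Local scaling property (LSP) in $\mathbb{R}^n$ (with $g(r)=r^n$): $\mathcal{F}=(F_j)_{j\in\mathbb{N}}$ satisfies the LSP with respect to $\kappa$, $0\le\kappa<1$, if there exist constants $c_3,c_4,r_1>0$ such that for any $0<r<r_1$, $\delta<r$, $j\in\mathbb{N}$ and $x\in F_j$, $$c_3\,\delta^{n-\kappa n} r^{\kappa n}\le\mathcal{H}^n(B(x,r)\cap\Delta(F_j,\delta))\le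 c_4\,\delta^{n-\kappa n}r^{\kappa n}.$$ For a sequence $\Upsilon=(\Upsilon_j)$ of non-negative reals, $\Lambda(\Upsilon):=\{x\in\mathbb{R}^n:x\in\Delta(F_j,\Upsilon_j)\text{ for infinitely many }j\in\mathbb{N}\}$, and $\Upsilon^{a}$ denotes the sequence $(\Upsilon_j^{a})_{j\in\mathbb{N}}$. *)

(* Defs.v *)
From HB Require Import structures.
From mathcomp Require Export all_boot all_order all_algebra.
From mathcomp Require Export all_classical all_reals all_analysis.

Set Implicit Arguments.
Unset Strict Implicit.
Unset Printing Implicit Defensive.

Export Order.TTheory GRing.Theory Num.Theory.
Export numFieldNormedType.Exports.

Local Open Scope classical_set_scope.
Local Open Scope ring_scope.

(* The norm that the library puts on 'rV[R]_n is the sup norm, and its [ball]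
   is the corresponding cube; R^n is taken here with its Euclidean distance. *)
Definition eucl_dist (R : realType) (n : nat) (x y : 'rV[R]_n) : R :=
  Num.sqrt (\sum_(i < n) (x ord0 i - y ord0 i) ^+ 2).

Definition eucl_ball (R : realType) (n : nat) (x : 'rV[R]_n) (r : R) :
    set 'rV[R]_n :=
  [set y | eucl_dist x y < r].

(* [D] indexes the cover, which may therefore be finite, empty or infinite. *)
Definition is_ball_cover (R : realType) (n : nat) (rho : R)
    (F : set 'rV[R]_n) (D : set nat) (c : nat -> 'rV[R]_n) (r : nat -> R) :
    Prop :=
  (forall i, D i -> 0 < r i < rho) /\
  F `<=` \bigcup_(i in D) eucl_ball (c i) (r i).

(* No normalising constant, and radii rather than diameters: for s = n this is
   a constant multiple of Lebesgue measure. *)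
Definition hausdorff_content (R : realType) (n : nat) (s rho : R)
    (F : set 'rV[R]_n) : \bar R :=
  ereal_inf [set v | exists (D : set nat) (c : nat -> 'rV[R]_n)
      (r : nat -> R),
      is_ball_cover rho F D c r /\ v = (\esum_(i in D) (r i `^ s)%:E)%E].

Definition hausdorff_measure (R : realType) (n : nat) (s : R)
    (F : set 'rV[R]_n) : \bar R :=
  lim (hausdorff_content s rho F @[rho --> 0^'+]).

(* The infimum makes sense for an arbitrary set; it is +oo when F is empty. *)
Definition dist_to_set (R : realType) (n : nat) (x : 'rV[R]_n)
    (F : set 'rV[R]_n) : \bar R :=
  ereal_inf [set (eucl_dist x y)%:E | y in F].

Definition nbhd_set (R : realType) (n : nat) (F : set 'rV[R]_n) (delta : R) :
    set 'rV[R]_n :=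
  [set x | (dist_to_set x F < delta%:E)%E].

Definition local_scaling_property (R : realType) (n : nat) (kappa : R)
    (F : nat -> set 'rV[R]_n) : Prop :=
  exists c3 c4 r1 : R,
    [/\ 0 < c3, 0 < c4, 0 < r1 &
      forall (r delta : R) (j : nat) (x : 'rV[R]_n),
        0 < r -> r < r1 -> 0 <= delta -> delta < r -> F j x ->
        let scale := delta `^ (n%:R - kappa * n%:R) * r `^ (kappa * n%:R) in
        let m := hausdorff_measure n%:R (eucl_ball x r `&` nbhd_set (F j) delta)
        in ((c3 * scale)%:E <= m)%E /\ (m <= (c4 * scale)%:E)%E].

Definition limsup_nbhd (R : realType) (n : nat) (F : nat -> set 'rV[R]_n)
    (Upsilon : nat -> R) : set 'rV[R]_n :=
  [set x | infinite_set [set j | nbhd_set (F j) (Upsilon j) x]].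

(* Main.v *)
Require Import Defs.
From mathcomp Require Import zify lra ring.

(* The only nontrivial range is s < n, where one shows that the s-measure of
   B /\ Lambda(Upsilon) is infinite. Work with dyadic cubes with a corner at the
   centre of B, and say that an open set has content w in a cube P when every
   cover by subcubes of P, of the small cubes of the set inside P, costs at
   least w, the cost of a cube of side l being l^s.

   Write k = kappa n and R_j = Upsilon_j^a, so that R_j^(n-k) = Upsilon_j^(s-k).
   For x in F_j and r = theta R_j, the lower LSP bound for B(x,r) and the upper
   LSP bound for the cubes of a cover show that a cover of
   B(x,r) /\ Delta(F_j,Upsilon_j) costs at least a constant times
   theta^(k-n) r^n: near x there is a "rich" cube of side about r, whose content
   exceeds its volume by a factor which is large when theta is small. The full
   measure hypothesis and a Vitali argument show that rich cubes fill a fixed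
   proportion f(theta) > 0 of every cube. Filling the complement again and
   again, rich cubes fill at least half of every cube, so that small cubes have
   content at least any given multiple of their volume. Hence the union of the
   Delta(F_j,Upsilon_j), j >= j0, has in every cube P the full content of P.

   Full content is inherited along nested families of cubes: this gives a
     compact
   subset of B /\ Lambda(Upsilon) with the same content as the union of all
   subcubes of a fixed generation g0 of a cube of B, for covers of generation at
   least g0, and this content tends to infinity with g0. *)

Set Implicit Arguments.
Unset Strict Implicit.
Unset Printing Implicit Defensive.

Local Open Scope ring_scope.

(** * Dyadic cubes and covers *)

(** Each [i] is related to at most one [j], so no term is counted twice. Typically the [f i] are the
    costs of the cubes of a cover, sorted by the disjoint cubes that contain them. *)
Lemma sum_fibers_le (R : realType) (I J : eqType) (s : seq I) (t : seq J)
    (r : I -> J -> bool) (f : I -> R) :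
  uniq t -> (forall i, i \in s -> 0 <= f i) ->
  (forall i j j', r i j -> r i j' -> j = j') ->
  \sum_(j <- t) \sum_(i <- s | r i j) f i <= \sum_(i <- s) f i.
Proof.
move=> ut f0 rI.
rewrite (eq_bigr (fun j => \sum_(i <- s) (if r i j then f i else 0)));
  last first.
  by move=> j _; rewrite big_mkcond.
rewrite exchange_big /= big_seq [leRHS]big_seq; apply: ler_sum => i si.
have [[j /andP[jt rij]]|nex] := pselect (exists j, (j \in t) && r i j).
  rewrite (bigD1_seq j) //= rij big1_seq ?addr0 // => j' /andP[j'j _].
  by case: ifP => // rij'; rewrite (rI _ _ _ rij rij') eqxx in j'j.
rewrite big1_seq ?f0 // => j /andP[_ jt]; case: ifP => // rij.
by case: nex; exists j; rewrite jt.
Qed.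

Section Dyadic.
Context (n : nat).

Definition idx := {ffun 'I_n -> nat}.
(** The pair [(q, z)] stands for the cube of side [2^-q] whose lower corner is [z * 2^-q] relative
    to an origin fixed later; a larger generation [q] means a smaller cube. *)
Definition cub := (nat * idx)%type.

Definition anc (h : nat) (z : idx) : idx := [ffun i => z i %/ 2 ^ h]%N.

Definition desc (h : nat) (z : idx) : seq idx :=
  [seq [ffun i => z i * 2 ^ h + v i]%N | v : {ffun 'I_n -> 'I_(2 ^ h)}].

Definition below (A P : cub) : bool :=
  (P.1 <= A.1)%N && (anc (A.1 - P.1) A.2 == P.2).

Lemma anc0 z : anc 0 z = z.
Proof. by apply/ffunP => i; rewrite ffunE expn0 divn1. Qed.

Lemma ancD h k z : anc (h + k) z = anc k (anc h z).
Proof. by apply/ffunP => i; rewrite !ffunE expnD divnMA. Qed.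

Lemma mem_desc h z y : (y \in desc h z) = (anc h y == z).
Proof.
apply/mapP/eqP => [[v _ ->]|<-].
  apply/ffunP => i; rewrite !ffunE divnMDl ?expn_gt0//.
  by rewrite divn_small ?addn0.
have lt2 i : (y i %% 2 ^ h < 2 ^ h)%N by rewrite ltn_mod expn_gt0.
exists [ffun i => Ordinal (lt2 i)]; first by rewrite mem_enum.
by apply/ffunP => i; rewrite !ffunE /= -divn_eq.
Qed.

Lemma desc_uniq h z : uniq (desc h z).
Proof.
apply/injectiveP => v w /ffunP vw; apply/ffunP => i; apply/val_inj.
by have := vw i; rewrite !ffunE => /addnI.
Qed.

Lemma size_desc h z : size (desc h z) = (2 ^ (h * n))%N.
Proof. by rewrite size_map -cardT card_ffun !card_ord -expnM. Qed.

Lemma desc0 z : desc 0 z = [:: z].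
Proof.
have := size_desc 0 z; rewrite mul0n expn0.
case E : (desc 0 z) => [|y [|]] // _.
have : y \in desc 0 z by rewrite E inE.
by rewrite mem_desc anc0 => /eqP ->.
Qed.

Lemma uniq_flatten_desc k (X : seq idx) :
  uniq X -> uniq (flatten [seq desc k z | z <- X]).
Proof.
elim: X => //= z X IH /andP[zX uX]; rewrite cat_uniq desc_uniq IH // andbT /=.
apply: contra zX => /hasP[y /flattenP[_ /mapP[w wX ->]]].
by rewrite !mem_desc => /eqP yw /eqP yz; rewrite -yz yw.
Qed.

Lemma desc_flatten h k z :
  perm_eq (desc (h + k) z) (flatten [seq desc k y | y <- desc h z]).
Proof.
have sub : {subset desc (h + k) z <= flatten [seq desc k y | y <- desc h z]}.
  move=> y; rewrite mem_desc addnC ancD => ay.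
  apply/flattenP; exists (desc k (anc k y)); last by rewrite mem_desc.
  by apply: map_f; rewrite mem_desc.
have sz : size (flatten [seq desc k y | y <- desc h z]) = size (desc (h + k) z).
  rewrite size_flatten /shape -map_comp sumnE big_map /=.
  under eq_bigr do rewrite size_desc.
  by rewrite big_const_seq count_predT size_desc iter_addn_0 size_desc -expnD
    -mulnDl addnC.
have [_ eqi] := uniq_min_size (desc_uniq _ _) sub (eq_leq sz).
by apply: uniq_perm; rewrite ?desc_uniq ?uniq_flatten_desc ?desc_uniq.
Qed.

Lemma belowE (A P : cub) :
  below A P = (P.1 <= A.1)%N && (A.2 \in desc (A.1 - P.1) P.2).
Proof. by rewrite /below mem_desc. Qed.

Lemma below_refl P : below P P.
Proof. by rewrite /below leqnn subnn anc0 eqxx. Qed.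

Lemma below_trans A B P : below A B -> below B P -> below A P.
Proof.
case: A B P => [a x] [b y] [p z]; rewrite /below /=.
move=> /andP[ba /eqP yE] /andP[pb /eqP zE]; rewrite (leq_trans pb ba) /=.
by rewrite -zE -yE -ancD addnBA // subnK.
Qed.

(** The ancestors of [A] form a chain, so dyadic cubes with a common subcube are nested. *)
Lemma below_cmp A P Q : below A P -> below A Q -> (P.1 <= Q.1)%N -> below Q P.
Proof.
case: A P Q => [a x] [p y] [q z]; rewrite /below /=.
move=> /andP[ba /eqP yE] /andP[pb /eqP zE] pq; rewrite pq /=.
by rewrite -zE -yE -ancD addnBA // subnK.
Qed.

Lemma below_gen A P : below A P -> (P.1 <= A.1)%N.
Proof. by case/andP. Qed.

Lemma below_eq A P Q : below A P -> below A Q -> P.1 = Q.1 -> P = Q.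
Proof.
move=> /andP[_ /eqP E1] /andP[_ /eqP E2] PQ.
by rewrite (surjective_pairing P) (surjective_pairing Q) -E1 -E2 PQ.
Qed.

Lemma below_antisym P Q : below P Q -> below Q P -> P = Q.
Proof.
move=> PQ QP; apply: (below_eq (below_refl P) PQ).
by apply/eqP; rewrite eqn_leq (below_gen PQ) (below_gen QP).
Qed.

End Dyadic.

Section Content.
Context (R : realType) (n : nat) (c : nat -> R).
Hypothesis c_ge0 : forall q, 0 <= c q.
Local Notation cub := (cub n).
Local Notation idx := (idx n).

(* Dyadic Hausdorff content in finite form. The cubes of a cover need not belong
   to [O], but must not be smaller than the cubes of [O] that they cover. *)
Definition cap (O : pred cub) (P : cub) (w : R) : Prop :=
  exists2 g0 : nat, (P.1 <= g0)%N &
  forall g, (g0 <= g)%N -> forall s : seq cub,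
    (forall A, A \in s -> below A P) ->
    (forall z, below (g, z) P -> O (g, z) -> has (below (g, z)) s) ->
    w <= \sum_(A <- s) c A.1.

Lemma cap_le O P w w' : w' <= w -> cap O P w -> cap O P w'.
Proof.
move=> ww' [g0 Pg0 H]; exists g0 => // g gg0 s sP sO.
exact: le_trans ww' (H _ gg0 _ sP sO).
Qed.

Lemma cap_ge0 O P w : w <= 0 -> cap O P w.
Proof.
move=> w0; exists P.1 => // g _ s _ _; apply: (le_trans w0).
by apply: sumr_ge0 => A _; exact: c_ge0.
Qed.

(** The generation from which a content bound holds depends on the cube; over a finite list the
    maximum of these generations serves for all. *)
Lemma seq_cap_gen (I : eqType) (O : I -> pred cub) (F : I -> cub) (w : I -> R)
    (t : seq I) :
  (forall y, y \in t -> cap (O y) (F y) (w y)) ->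
  exists g0 : nat, forall y, y \in t -> ((F y).1 <= g0)%N /\
  forall g, (g0 <= g)%N -> forall s : seq cub,
    (forall A, A \in s -> below A (F y)) ->
    (forall z, below (g, z) (F y) -> O y (g, z) -> has (below (g, z)) s) ->
    w y <= \sum_(A <- s) c A.1.
Proof.
elim: t => [|x t IH] H; first by exists 0.
have [|g1 H1] := IH; first by move=> y yt; apply: H; rewrite inE yt orbT.
have [g2 Fg2 H2] := H x (mem_head _ _).
exists (maxn g1 g2) => y; rewrite inE => /orP[/eqP->|yt].
  split; first by rewrite (leq_trans Fg2) ?leq_maxr.
  by move=> g; rewrite geq_max => /andP[_]; exact: H2.
have [H3 H4] := H1 _ yt.
split; first by rewrite (leq_trans H3) ?leq_maxl.
by move=> g; rewrite geq_max => /andP[+ _]; exact: H4.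
Qed.

(** A cover that contains [P] already costs [c P.1], which is enough by hypothesis; any other cover
    splits into separate covers of the children. *)
Lemma cap_children O (P : cub) (w : idx -> R) :
  (forall y, y \in desc 1 P.2 -> cap O (P.1.+1, y) (w y)) ->
  \sum_(y <- desc 1 P.2) w y <= c P.1 ->
  cap O P (\sum_(y <- desc 1 P.2) w y).
Proof.
move=> /(seq_cap_gen (O := fun=> O) (F := fun y => (P.1.+1, y))) [g0 Hg0] wc.
exists (maxn g0 P.1); first by rewrite leq_maxr.
move=> g; rewrite geq_max => /andP[gg0 Pg] s sP sO.
have [Ps|Ps] := boolP (P \in s).
  apply: (le_trans wc); rewrite (big_rem P) //= lerDl.
  by apply: sumr_ge0 => A _; exact: c_ge0.
apply: le_trans (sum_fibers_le (r := fun A y => below A (P.1.+1, y))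
  (desc_uniq 1 P.2) (fun A _ => c_ge0 A.1) _); last first.
  by move=> A y y' /below_eq Ay /Ay /(_ erefl) [].
rewrite big_seq [leRHS]big_seq; apply: ler_sum => y yP.
have yPb : below (P.1.+1, y) P by rewrite belowE /= leqnSn subSnn.
rewrite -big_filter; apply: (Hg0 y yP).2 gg0 _ _ _.
  by move=> A; rewrite mem_filter => /andP[].
move=> z zy Oz; have := sO z (below_trans zy yPb) Oz.
move=> /hasP[A As zA]; apply/hasP; exists A => //; rewrite mem_filter As andbT.
apply: (below_cmp zy zA) => /=; have := sP _ As => AP.
rewrite ltn_neqAle (below_gen AP) andbT; apply: contra Ps => /eqP PA.
by rewrite -(below_eq (below_refl A) AP).
Qed.

(* Covers of one level turn into covers of the previous one without raising
   the cost: the subcubes of an uncovered cube [P] are replaced by [P]. *)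
Lemma cover_lift (O : pred cub) (g0 g g' : nat) (X X' : seq idx) (T : R) :
  uniq X -> (g0 <= g)%N ->
  (forall z, z \in X -> forall s : seq cub,
    (forall A, A \in s -> below A (g, z)) ->
    (forall y, below (g', y) (g, z) -> O (g', y) -> has (below (g', y)) s) ->
    c g <= \sum_(A <- s) c A.1) ->
  (forall y, O (g', y) -> has (fun z => below (g', y) (g, z)) X -> y \in X') ->
  (forall s : seq cub, (forall A, A \in s -> (g0 <= A.1)%N) ->
     (forall z, z \in X -> has (below (g, z)) s) ->
     T <= \sum_(A <- s) c A.1) ->
  forall s : seq cub, (forall A, A \in s -> (g0 <= A.1)%N) ->
     (forall y, y \in X' -> has (below (g', y)) s) ->
     T <= \sum_(A <- s) c A.1.
Proof.
move=> uX g0g cX XX' HT s sg0 sX'.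
pose Y := [seq z <- X | ~~ has (below (g, z)) s].
pose s1 := [seq A <- s | (A.1 <= g)%N] ++ [seq (g, z) | z <- Y].
apply: (@le_trans _ _ (\sum_(A <- s1) c A.1)).
  apply: HT => [A|z zX].
    rewrite mem_cat mem_filter => /orP[/andP[_ /sg0]//|/mapP[z _ ->]//].
  rewrite has_cat; case: (boolP (has (below (g, z)) s)) => [/hasP[A As zA]|nz].
    apply/orP; left; apply/hasP; exists A => //.
    by rewrite mem_filter As (below_gen zA).
  apply/orP; right; apply/hasP; exists (g, z); last exact: below_refl.
  by apply: map_f; rewrite mem_filter nz.
rewrite /s1 big_cat big_filter big_map /= [leRHS](bigID (fun A => A.1 <= g)%N)
  /=.
rewrite lerD2l -[leRHS]big_filter.
apply: le_trans (sum_fibers_le (r := fun A y => below A (g, y))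
  (filter_uniq _ uX) (fun A _ => c_ge0 A.1) _); last first.
  by move=> A y y' /below_eq Ay /Ay /(_ erefl) [].
rewrite big_seq [leRHS]big_seq; apply: ler_sum => z.
rewrite mem_filter => /andP[nz zX].
rewrite -big_filter; apply: (cX z zX).
  by move=> A; rewrite mem_filter => /andP[].
move=> y yz Oy; have yX' : y \in X' by apply: XX' => //; apply/hasP; exists z.
have /hasP[A As yA] := sX' _ yX'; apply/hasP; exists A => //.
have gA : (g < A.1)%N.
  rewrite ltnNge; apply: contra nz => Ag; apply/hasP; exists A => //.
  exact: below_cmp yA yz Ag.
by rewrite !mem_filter As -ltnNge gA (below_cmp yz yA) // ltnW.
Qed.

End Content.

(** * Filling cubes by rich subcubes *)

Lemma geometric_half (R : realType) (f : R) :
  0 < f -> f <= 1 -> exists t : nat, (1 - f) ^+ t <= 2^-1.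
Proof.
move=> f0 f1.
(* Bernoulli's inequality in product form; any [t] with [t * f >= 1] then gives the bound one
   half. *)
have bern t : (1 - f) ^+ t * (1 + t%:R * f) <= 1.
  elim: t => [|t IH]; first by rewrite expr0 mul0r addr0 mulr1.
  apply: le_trans IH; rewrite exprSr -mulrA ler_wpM2l ?exprn_ge0 ?subr_ge0 //.
  rewrite -natr1; have : 0 <= (t%:R + 1) * f ^+ 2 by rewrite mulr_ge0 ?addr_ge0
    ?sqr_ge0.
  lra.
exists (Num.truncn f^-1).+1.
have := bern (Num.truncn f^-1).+1; set t := _.+1 => bt.
have tf : 1 <= t%:R * f.
  rewrite -ler_pdivrMr // div1r; apply: ltW; exact: truncnS_gt.
have e0 : 0 <= (1 - f) ^+ t by rewrite exprn_ge0 // subr_ge0.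
suff : (1 - f) ^+ t * 2 <= 1 by lra.
by apply: le_trans bt; rewrite ler_wpM2l //; lra.
Qed.

Section Volume.
Context (R : realType) (n : nat).

Definition vol (q : nat) : R := 2^-1 ^+ (q * n).

Lemma vol_gt0 q : 0 < vol q.
Proof. by rewrite exprn_gt0 // invr_gt0. Qed.

Lemma volD q k : vol (q + k) * (2 ^ (k * n))%:R = vol q.
Proof.
rewrite /vol mulnDl exprD -mulrA natrX -exprMn mulVf ?pnatr_eq0 //.
by rewrite expr1n mulr1.
Qed.

Lemma sum_vol k (z : idx n) q : \sum_(y <- desc k z) vol (q + k) = vol q.
Proof.
by rewrite big_const_seq count_predT size_desc iter_addr_0 -mulr_natr volD.
Qed.

End Volume.

Section Density.
Context (R : realType) (n : nat) (c : nat -> R).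
Hypothesis c_ge0 : forall q, 0 <= c q.
Local Notation cub := (cub n).
Local Notation idx := (idx n).
Local Notation vol := (vol R n).

(** Volumes add up over children, and by the second hypothesis no cube on the way up costs less than
    [e] times its volume, so [cap_children] applies at every generation. *)
Lemma cap_up O (P : cub) (e : R) (k : nat) :
  0 <= e -> (forall q, (P.1 <= q)%N -> e * vol q <= c q) ->
  (forall Q : cub, Q.1 = (P.1 + k)%N -> cap c O Q (e * vol Q.1)) ->
  cap c O P (e * vol P.1).
Proof.
move=> e0; elim: k P => [|k IH] P ec HQ; first by apply: HQ; rewrite addn0.
have E : e * vol P.1 = \sum_(y <- desc 1 P.2) e * vol P.1.+1.
  by rewrite -mulr_sumr -[P.1.+1]addn1 sum_vol.
rewrite E; apply: cap_children => //; last by rewrite -E ec.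
move=> y _; apply: (IH (P.1.+1, y)) => [q Pq|Q QE].
  by apply: ec; exact: ltnW.
by apply: HQ; rewrite QE addSnnS.
Qed.

Section Fill.
Context (O rich : pred cub) (D : R) (p0 : nat).
Hypothesis D_ge0 : 0 <= D.
Hypothesis Dc : forall q, (p0 <= q)%N -> D * vol q <= c q.
Hypothesis cap_rich : forall Q, rich Q -> cap c O Q (D * vol Q.1).

(** For [(m, z)] inside [Q]: some rich subcube of [Q] contains [(m, z)]. The index [i] is the number
    of generations to go up from [m], and stops at the generation of [Q]. *)
Definition mark (m : nat) (Q : cub) (z : idx) : bool :=
  [exists i : 'I_(m - Q.1).+1, rich ((m - i)%N, anc i z)].

Lemma mark_child k (Q : cub) y z :
  ~~ rich Q -> y \in desc 1 Q.2 -> z \in desc k y ->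
  mark (Q.1 + k.+1) Q z = mark (Q.1.+1 + k) (Q.1.+1, y) z.
Proof.
rewrite !mem_desc => nQ /eqP yQ /eqP zy.
have zQ : anc k.+1 z = Q.2 by rewrite -addn1 ancD zy.
rewrite /mark addnS addSn.
apply/existsP/existsP => -[[i /= ilt] ri].
  have ik : i != k.+1.
    apply: contra nQ => /eqP ik; move: ri; rewrite ik zQ subSS addnK.
    by rewrite -surjective_pairing.
  have ilt' : (i < ((Q.1 + k).+1 - Q.1.+1).+1)%N by lia.
  by exists (Ordinal ilt').
have ilt' : (i < ((Q.1 + k).+1 - Q.1).+1)%N by move: ilt => /=; lia.
by exists (Ordinal ilt').
Qed.

(** Cells inside rich cubes count with density [D], the others with density [tau * D]. In the
    induction on [k], a rich [Q] has enough content by itself; if [Q] is not rich, marks relative to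
    [Q] agree with marks relative to its children, and the contents of the children add up. *)
Lemma cap_mark (tau : R) k (Q : cub) :
  0 <= tau -> tau <= 1 ->
  (forall Q, (p0 <= Q.1)%N -> cap c O Q (tau * D * vol Q.1)) ->
  (p0 <= Q.1)%N ->
  cap c O Q (\sum_(z <- desc k Q.2)
    D * vol (Q.1 + k) * (if mark (Q.1 + k) Q z then 1 else tau)).
Proof.
move=> t0 t1 good.
have le1 (m : nat) (b : bool) : D * vol m * (if b then 1 else tau) <= D * vol m.
  rewrite ler_piMr ?mulr_ge0 ?(ltW (vol_gt0 _ _ _)) //.
  by case: b.
elim: k Q => [|k IH] Q pQ.
  rewrite desc0 big_seq1 addn0; case: ifPn => [|_].
    move=> /existsP[[i /= +]]; rewrite subnn ltnS leqn0 => /eqP ->.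
    by rewrite anc0 subn0 -surjective_pairing mulr1 => /cap_rich.
  by rewrite mulrC mulrA; exact: good.
have lesum : \sum_(z <- desc k.+1 Q.2) D * vol (Q.1 + k.+1) *
     (if mark (Q.1 + k.+1) Q z then 1 else tau) <= D * vol Q.1.
  rewrite -(sum_vol R k.+1 Q.2 Q.1) mulr_sumr; apply: ler_sum => z _;
    exact: le1.
have [rQ|nQ] := boolP (rich Q).
  exact: cap_le lesum (cap_rich rQ).
pose w y := \sum_(z <- desc k y)
    D * vol (Q.1.+1 + k) * (if mark (Q.1.+1 + k) (Q.1.+1, y) z then 1 else tau).
have E : \sum_(z <- desc k.+1 Q.2)
    D * vol (Q.1 + k.+1) * (if mark (Q.1 + k.+1) Q z then 1 else tau) =
    \sum_(y <- desc 1 Q.2) w y.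
  rewrite -(add1n k) (perm_big _ (desc_flatten 1 k Q.2)) /= big_flatten big_map.
  rewrite big_seq [RHS]big_seq; apply: eq_bigr => y yQ.
  rewrite /w big_seq [RHS]big_seq; apply: eq_bigr => z zy.
  by rewrite -(mark_child nQ yQ zy) add1n addSnnS.
rewrite E in lesum *; apply: cap_children => //.
  by move=> y yQ; apply: (IH (Q.1.+1, y)); exact: leqW.
exact: le_trans lesum (Dc pQ).
Qed.

(** One round of filling: a proportion at least [f] of the cells is raised from density [tau * D] to
    density [D], which improves the average. *)
Lemma cap_density_step (f tau : R) :
  0 <= tau -> tau <= 1 ->
  (forall Q : cub, (p0 <= Q.1)%N -> exists k,
     f * (2 ^ (k * n))%:R <= (count (mark (Q.1 + k) Q) (desc k Q.2))%:R) ->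
  (forall Q, (p0 <= Q.1)%N -> cap c O Q (tau * D * vol Q.1)) ->
  forall Q, (p0 <= Q.1)%N -> cap c O Q ((tau + f * (1 - tau)) * D * vol Q.1).
Proof.
move=> t0 t1 Hf good Q pQ; have [k Hk] := Hf Q pQ.
apply: cap_le (cap_mark k t0 t1 good pQ).
rewrite -mulr_sumr.
set M := mark _ _ in Hk *.
have -> : \sum_(z <- desc k Q.2) (if M z then 1 else tau) =
    tau * (2 ^ (k * n))%:R + (1 - tau) * (count M (desc k Q.2))%:R.
  rewrite -(size_desc k Q.2) -sum1_count -sum1_size !natr_sum !mulr_sumr.
  rewrite [X in _ + X]big_mkcond -big_split /=; apply: eq_bigr => z _.
  by case: (M z); lra.
rewrite -(volD R n Q.1 k).
set v := vol _; set N := (2 ^ _)%:R in Hk *; set C := (count _ _)%:R in Hk *.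
have : 0 <= D * v * ((1 - tau) * (C - f * N)).
  by rewrite !mulr_ge0 ?subr_ge0 // ltW // vol_gt0.
set x := (1 - tau); have -> : tau = 1 - x by rewrite /x; lra.
lra.
Qed.

(** Starting from density 0, the missing proportion is multiplied by [1 - f] in each round, so [t]
    rounds leave [(1 - f) ^+ t]. *)
Lemma cap_half (f : R) :
  0 < f -> f <= 1 ->
  (forall Q : cub, (p0 <= Q.1)%N -> exists k,
     f * (2 ^ (k * n))%:R <= (count (mark (Q.1 + k) Q) (desc k Q.2))%:R) ->
  forall Q, (p0 <= Q.1)%N -> cap c O Q (2^-1 * D * vol Q.1).
Proof.
move=> f0 f1 Hf.
have H t : forall Q, (p0 <= Q.1)%N ->
    cap c O Q ((1 - (1 - f) ^+ t) * D * vol Q.1).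
  elim: t => [|t IH] Q pQ.
    by rewrite expr0 subrr !mul0r; exact: cap_ge0.
  have -> : 1 - (1 - f) ^+ t.+1 =
      (1 - (1 - f) ^+ t) + f * (1 - (1 - (1 - f) ^+ t)).
    by rewrite exprS; lra.
  apply: cap_density_step => //.
    by rewrite subr_ge0 exprn_ile1 ?subr_ge0 //; lra.
  by rewrite gerBl exprn_ge0 // subr_ge0.
have [t Ht] := geometric_half f0 f1.
move=> Q pQ; apply: cap_le (H t Q pQ).
by rewrite -!mulrA ler_wpM2r ?mulr_ge0 ?(ltW (vol_gt0 _ _ _)) //; lra.
Qed.

End Fill.
End Density.

(** * Nested families of cubes *)

Section Tree.
Context (R : realType) (n : nat) (c : nat -> R).
Hypothesis c_ge0 : forall q, 0 <= c q.
Local Notation cub := (cub n).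
Local Notation idx := (idx n).

(** Level [N.+1] keeps the descendants of level [N] that lie in [O N], at a generation so fine that
    the full content of every cube of level [N] is visible there. By [cover_lift] the lower bound on
    the cost of covers is then never lost; at level 0 it is the number of cubes times the cost of
    one. *)
Lemma cap_full_tree (O : nat -> pred cub) (P : cub) (h : nat) :
  (forall N Q, cap c (O N) Q (c Q.1)) ->
  exists (g : nat -> nat) (X : nat -> seq idx),
  [/\ g 0 = (P.1 + h)%N, X 0 = desc h P.2,
      forall N, (g N < g N.+1)%N,
      forall N z, z \in X N.+1 ->
        O N (g N.+1, z) /\ anc (g N.+1 - g N) z \in X N &
      forall N (s : seq cub), (forall A, A \in s -> (g 0 <= A.1)%N) ->
        (forall z, z \in X N -> has (below (g N, z)) s) ->
        (2 ^ (h * n))%:R * c (P.1 + h)%N <= \sum_(A <- s) c A.1].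
Proof.
move=> full.
pose step (a : nat * (nat * seq idx)) (b : nat * seq idx) :=
  let: (N, (g, X)) := a in let: (g', X') := b in
  [/\ (g < g')%N, uniq X', forall y, y \in X' ->
        O N (g', y) /\ anc (g' - g) y \in X &
   uniq X -> forall g0 T, (g0 <= g)%N ->
  (forall s : seq cub, (forall A, A \in s -> (g0 <= A.1)%N) ->
     (forall z, z \in X -> has (below (g, z)) s) ->
     T <= \sum_(A <- s) c A.1) ->
  forall s : seq cub, (forall A, A \in s -> (g0 <= A.1)%N) ->
     (forall y, y \in X' -> has (below (g', y)) s) ->
     T <= \sum_(A <- s) c A.1].
have /choice[f Hf] : forall a, exists b, step a b.
  case=> N [g X].
  have [G HG] : exists G : nat, forall z, z \in X -> (g <= G)%N /\
      forall g', (G <= g')%N -> forall s : seq cub,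
      (forall A, A \in s -> below A (g, z)) ->
      (forall y, below (g', y) (g, z) -> O N (g', y) -> has (below (g', y)) s)
        ->
      c g <= \sum_(A <- s) c A.1.
    exact: (seq_cap_gen (O := fun=> O N) (F := fun z => (g, z))
      (w := fun=> c g) (t := X) (fun z _ => full N (g, z))).
  (* The maximum with [g.+1] makes the generations strictly increasing. *)
  pose g' := maxn G g.+1.
  pose Y := [seq y <- flatten [seq desc (g' - g) z | z <- X] | O N (g', y)].
  have gg' : (g < g')%N by rewrite leq_maxr.
  exists (g', undup Y); split => //; first exact: undup_uniq.
    move=> y; rewrite mem_undup mem_filter => /andP[-> /flattenP[_ /mapP[z zX
      ->]]].
    by rewrite mem_desc => /eqP ->.
  move=> uX g0 T g0g HT;
    apply: (cover_lift c_ge0 uX g0g _ _ HT (g' := g')) => [z zX|y Oy].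
    by apply: (HG z zX).2; rewrite leq_maxl.
  move=> /hasP[z zX yz]; rewrite mem_undup mem_filter Oy /=.
  apply/flattenP; exists (desc (g' - g) z); first exact: map_f.
  by move: yz; rewrite belowE => /andP[].
pose fix S (N : nat) : nat * seq idx :=
  if N is N'.+1 then f (N', S N') else ((P.1 + h)%N, desc h P.2).
have HS N : step (N, S N) (S N.+1) by exact: Hf.
exists (fun N => (S N).1), (fun N => (S N).2).
have SP N : (S N) = ((S N).1, (S N).2) by exact: surjective_pairing.
split => //.
- by move=> N; have := HS N; rewrite (SP N) (SP N.+1) => -[].
- move=> N z; have := HS N; rewrite (SP N) (SP N.+1) => -[_ _ H _]; exact: H.
- have uS N : uniq (S N).2.
    case: N => [|N]; first exact: desc_uniq.
    by have := HS N; rewrite (SP N) (SP N.+1) => -[].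
  have gS N : ((S 0).1 <= (S N).1)%N.
    elim: N => // N IH; apply: (leq_trans IH).
    by have := HS N; rewrite (SP N) (SP N.+1) => -[/ltnW].
  elim=> [|N IH].
    move=> s sg sX; rewrite -(size_desc h P.2).
    apply: le_trans (sum_fibers_le (r := fun A y => A == ((P.1 + h)%N, y))
      (desc_uniq h P.2) (fun A _ => c_ge0 A.1) _).
    2: by move=> A y y' /eqP -> /eqP [].
    rewrite -sum1_size natr_sum mulr_suml big_seq [leRHS]big_seq.
    apply: ler_sum => z zP; rewrite mul1r.
    (* Cubes larger than those of level 0 are excluded by [sg], so the cube that covers [z] is the
       cube of [z] itself. *)
    have /hasP[[q y] As zA] := sX _ zP.
    have AE : (q, y) = ((P.1 + h)%N, z).
      apply/esym/(below_eq (below_refl _) zA) => /=.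
      by apply/eqP; rewrite eqn_leq (below_gen zA) (sg _ As).
    rewrite {}AE in As zA; rewrite (big_rem _ As) /= eqxx lerDl.
    by apply: sumr_ge0 => A _; exact: c_ge0.
  by have := HS N; rewrite {1}(SP N) (SP N.+1) => -[_ _ _ H];
    exact: H (uS N) _ _ (gS N) IH.
Qed.

End Tree.

(** * A dyadic Vitali lemma *)

Section Vitali.
Context (n : nat).
Local Notation cub := (cub n).
Local Notation idx := (idx n).

(** Sup-distance at most [K] between indices, written additively because subtraction of naturals
    truncates. *)
Definition close (K : nat) (y z : idx) : Prop :=
  forall i, (y i <= z i + K)%N /\ (z i <= y i + K)%N.

Lemma close_anc K h y z : close K y z -> close K (anc h y) (anc h z).
Proof.
move=> yz i; rewrite !ffunE.
have div_le a b : (a <= b + K)%N -> (a %/ 2 ^ h <= b %/ 2 ^ h + K)%N.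
  move=> ab; have h0 : (0 < 2 ^ h)%N by rewrite expn_gt0.
  rewrite [leqRHS]addnC -divnMDl // leq_div2r // (leq_trans ab) // addnC
    leq_add2r.
  exact: leq_pmulr.
by have [] := yz i; split; apply: div_le.
Qed.

(* Vitali covering for dyadic cubes: the neighbourhoods of nested cubes are
   nested, so it suffices to keep the maximal ones, which are disjoint. *)
Lemma vitali_count (rich : pred cub) (m K : nat) (P : cub) (Z : seq idx) :
  uniq Z ->
  (forall z, z \in Z -> exists Q, [/\ rich Q, below Q P, (Q.1 <= m)%N &
    close K (anc (m - Q.1) z) Q.2]) ->
  (size Z <= (K.*2.+1) ^ n * count (mark rich m P) (desc (m - P.1) P.2))%N.
Proof.
move=> uZ HZ.
(* [Q z] has the least generation among the rich cubes close to [z]. It is then maximal among the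
   rich subcubes of [P]: by [close_anc], a larger one containing it would be close to [z] too. *)
have /choice[Q HQ] : forall z, exists Q, z \in Z ->
   [/\ rich Q, below Q P, (Q.1 <= m)%N, close K (anc (m - Q.1) z) Q.2 &
    forall Q', rich Q' -> below Q' P -> below Q Q' -> Q' = Q].
  move=> z; have [zZ|] := boolP (z \in Z); last by exists (0%N, z).
  pose good q := `[< exists Q, [/\ rich Q, below Q P, (Q.1 <= m)%N,
    close K (anc (m - Q.1) z) Q.2 & Q.1 = q] >].
  have exg : exists q, good q.
    have [Q [? ? ? ?]] := HZ z zZ; exists Q.1; apply/asboolP; by exists Q.
  case: (ex_minnP exg) => q /asboolP[Q [rQ QP Qm Qz Qq]] qmin.
  exists Q => _; split => // Q' rQ' QP' QQ'; apply/esym/(below_antisym QQ').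
  have Q'Q := below_gen QQ'.
  apply: (below_cmp (below_refl Q) QQ'); rewrite Qq; apply: qmin; apply/asboolP.
  exists Q'; split => //; first exact: leq_trans Q'Q Qm.
  have -> : (m - Q'.1 = (m - Q.1) + (Q.1 - Q'.1))%N by lia.
  rewrite ancD; move: QQ'; rewrite /below => /andP[_ /eqP <-].
  exact: close_anc.
(* [phi z] moves [z] into [Q z], keeping its position relative to its own ancestor; [v z] records
   the displacement, shifted by [K] to be non-negative. Since [phi z] lies in only one maximal rich
   cube, the pair determines [z]. *)
pose phi z : idx := [ffun i =>
  (Q z).2 i * 2 ^ (m - (Q z).1) + z i %% 2 ^ (m - (Q z).1)]%N.
pose v z : {ffun 'I_n -> 'I_(K.*2.+1)} :=
  [ffun i => inord (anc (m - (Q z).1) z i + K - (Q z).2 i)%N].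
have anc_phi z : anc (m - (Q z).1) (phi z) = (Q z).2.
  apply/ffunP => i; rewrite !ffunE divnMDl ?expn_gt0 // divn_small ?addn0 //.
  by rewrite ltn_mod expn_gt0.
have phiQ z : z \in Z -> below (m, phi z) (Q z).
  by move=> /HQ[_ _ Qm _ _]; rewrite /below Qm anc_phi eqxx.
have vE z i : z \in Z -> (v z i = anc (m - (Q z).1) z i + K - (Q z).2 i :>
  nat)%N.
  move=> /HQ[_ _ _ /(_ i)[c1 c2] _]; rewrite [v z]/v ffunE inordK //; lia.
have inj : {in Z &, injective (fun z => (phi z, v z))}.
  move=> z1 z2 z1Z z2Z [phi12 v12].
  have Q12 : Q z1 = Q z2.
    have := phiQ _ z1Z; have := phiQ _ z2Z; rewrite -phi12 => b2 b1.
    have [r1 P1 _ _ m1] := HQ _ z1Z; have [r2 P2 _ _ m2] := HQ _ z2Z.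
    have [le12|/ltnW le21] := leqP (Q z1).1 (Q z2).1.
      by apply: m2 => //; exact: below_cmp b1 b2 le12.
    by apply/esym/m1 => //; exact: below_cmp b2 b1 le21.
  apply/ffunP => i.
  have := vE _ i z1Z; rewrite v12 (vE _ i z2Z) Q12.
  have [_ _ _ /(_ i)[+ +] _] := HQ _ z1Z;
    have [_ _ _ /(_ i)[+ +] _] := HQ _ z2Z.
  rewrite Q12 !ffunE.
  have /ffunP/(_ i) := phi12; rewrite !ffunE Q12 => /addnI m12 *.
  rewrite (divn_eq (z1 i) (2 ^ (m - (Q z2).1))).
  rewrite [RHS](divn_eq (z2 i) (2 ^ (m - (Q z2).1))) m12.
  congr (_ * _ + _)%N; lia.
have := uniq_leq_size (s1 := [seq (phi z, v z) | z <- Z])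
  (s2 := [seq (y, w) | y <- [seq y <- desc (m - P.1) P.2 | mark rich m P y],
     w <- enum {ffun 'I_n -> 'I_(K.*2.+1)}]).
rewrite (map_inj_in_uniq inj) size_map size_allpairs -cardT card_ffun !card_ord.
rewrite size_filter mulnC; apply=> // -[y w] /mapP[z zZ [-> ->]].
apply/allpairsP; exists (phi z, v z); rewrite mem_enum; split => //.
have [rQ QP Qm _ _] := HQ _ zZ.
have zP := below_trans (phiQ _ zZ) QP.
rewrite mem_filter; apply/andP; split; last first.
  by move: zP; rewrite belowE => /andP[].
have ilt : (m - (Q z).1 < (m - P.1).+1)%N by rewrite ltnS leq_sub2l //
  below_gen.
apply/existsP; exists (Ordinal ilt) => /=.
by rewrite subKn // anc_phi -surjective_pairing.
Qed.

End Vitali.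

(** * Euclidean distance and dyadic cubes of space *)

Local Open Scope classical_set_scope.
Local Open Scope ring_scope.

Section Euclid.
Context (R : realType) (n : nat).
Implicit Types x y z : 'rV[R]_n.

Lemma cauchy_schwarz_sum (a b : 'I_n -> R) :
  (\sum_i a i * b i) ^+ 2 <= (\sum_i a i ^+ 2) * (\sum_i b i ^+ 2).
Proof.
set A := \sum_i a i ^+ 2; set B := \sum_i a i * b i; set C := \sum_i b i ^+ 2.
have C0 : 0 <= C by apply: sumr_ge0 => i _; exact: sqr_ge0.
have : 0 <= \sum_i (C * a i - B * b i) ^+ 2.
  by apply: sumr_ge0 => i _; exact: sqr_ge0.
have -> : \sum_i (C * a i - B * b i) ^+ 2 = C * (A * C - B ^+ 2).
  rewrite (eq_bigr (fun i => C ^+ 2 * a i ^+ 2 + (- (2 * C * B)) * (a i * b i)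
    + B ^+ 2 * b i ^+ 2)); last by move=> i _; ring.
  rewrite !big_split /= -!mulr_sumr -/A -/B -/C; ring.
move: C0; rewrite le_eqVlt => /predU1P[C0 _|C0];
  last by rewrite pmulr_rge0 // subr_ge0.
have b0 i : b i = 0.
  apply/eqP; rewrite -sqrf_eq0; move/esym/eqP: C0.
  rewrite psumr_eq0 => [/allP/(_ i)|j _]; last exact: sqr_ge0.
  by rewrite mem_index_enum => /(_ isT).
by rewrite /B big1 ?expr0n /= ?mulr_ge0 ?sumr_ge0 // => i _;
  rewrite ?sqr_ge0 // b0 mulr0.
Qed.

Lemma eucl_dist_ge0 x y : 0 <= eucl_dist x y.
Proof. exact: sqrtr_ge0. Qed.

Lemma eucl_distC x y : eucl_dist x y = eucl_dist y x.
Proof. by congr Num.sqrt; apply: eq_bigr => i _; ring. Qed.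

Lemma eucl_distD x y z : eucl_dist x z <= eucl_dist x y + eucl_dist y z.
Proof.
rewrite -(ler_pXn2r (n := 2)) ?nnegrE ?addr_ge0 ?eucl_dist_ge0 //.
pose a i := x ord0 i - y ord0 i; pose b i := y ord0 i - z ord0 i.
have sq u v : eucl_dist u v ^+ 2 = \sum_(i < n) (u ord0 i - v ord0 i) ^+ 2.
  by rewrite sqr_sqrtr // sumr_ge0 // => i _; exact: sqr_ge0.
rewrite sqrrD !sq.
have -> : \sum_(i < n) (x ord0 i - z ord0 i) ^+ 2 =
    \sum_i a i ^+ 2 + (\sum_i a i * b i) *+ 2 + \sum_i b i ^+ 2.
  rewrite -mulr_natr mulr_suml -!big_split /=; apply: eq_bigr => i _.
  by rewrite /a /b; ring.
rewrite lerD2r lerD2l lerMn2r /=.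
apply: le_trans (ler_norm _) _; rewrite -sqrtr_sqr /eucl_dist -sqrtrM.
  by rewrite ler_wsqrtr // cauchy_schwarz_sum.
by apply: sumr_ge0 => i _; exact: sqr_ge0.
Qed.

Lemma coord_le_eucl_dist x y i : `|x ord0 i - y ord0 i| <= eucl_dist x y.
Proof.
rewrite -sqrtr_sqr ler_wsqrtr // (bigD1 i) //= lerDl.
by apply: sumr_ge0 => j _; exact: sqr_ge0.
Qed.

Lemma eucl_dist_le_coord x y (e : R) :
  (forall i, `|x ord0 i - y ord0 i| <= e) -> eucl_dist x y <= n%:R * e.
Proof.
move=> xy; have [n0|n0] := posnP n.
  rewrite /eucl_dist big1 ?sqrtr0 ?n0 ?mul0r // => i.
  by have := ltn_ord i; rewrite {2}n0.
have e0 : 0 <= e by exact: le_trans (normr_ge0 _) (xy (Ordinal n0)).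
rewrite -[leRHS]ger0_norm ?mulr_ge0 // -sqrtr_sqr ler_wsqrtr //.
apply: (@le_trans _ _ (\sum_(i < n) e ^+ 2)).
  by apply: ler_sum => i _; rewrite -real_normK ?num_real // ler_pXn2r ?nnegrE.
rewrite exprMn sumr_const card_ord -[leLHS]mulr_natl;
  rewrite ler_wpM2r ?sqr_ge0 //.
by rewrite expr2 -natrM ler_nat leq_pmulr.
Qed.

Lemma open_eucl_ball x (r : R) : open (eucl_ball x r).
Proof.
rewrite openE => y /= yr; apply/nbhs_ballP.
have n0 : 0 < n%:R + 1 :> R by rewrite ltr_wpDl.
have e0 : 0 < (r - eucl_dist x y) / (n%:R + 1) by rewrite divr_gt0 // subr_gt0.
exists ((r - eucl_dist x y) / (n%:R + 1)) => // z [_ yz]; rewrite /eucl_ball /=.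
have H : eucl_dist y z <= n%:R * ((r - eucl_dist x y) / (n%:R + 1)).
  by apply: eucl_dist_le_coord => i; exact: ltW (yz ord0 i).
apply: le_lt_trans (eucl_distD x y z) _; rewrite -ltrBrDl.
apply: le_lt_trans H _; rewrite mulrCA gtr_pMr ?subr_gt0 //.
by rewrite ltr_pdivrMr // mul1r ltrDl.
Qed.

Lemma nbhd_setP (F : set 'rV[R]_n) (d : R) x :
  nbhd_set F d x <-> exists2 y, F y & eucl_dist x y < d.
Proof.
split=> [|[y Fy xy]].
  by move=> /ereal_inf_lt[_ [y Fy <-]]; rewrite lte_fin; exists y.
apply: (@le_lt_trans _ _ (eucl_dist x y)%:E); last by rewrite lte_fin.
by apply: ereal_inf_lbound; exists y.
Qed.

End Euclid.

Section Cubes.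
Context (R : realType) (n : nat) (o : 'rV[R]_n).
Local Notation cub := (cub n).
Local Notation idx := (idx n).
Implicit Types x y : 'rV[R]_n.

Definition ell (q : nat) : R := 2^-1 ^+ q.

Lemma ell_gt0 q : 0 < ell q.
Proof. by rewrite exprn_gt0 // invr_gt0. Qed.

Lemma ellD q k : ell (q + k) * (2 ^ k)%:R = ell q.
Proof.
by rewrite /ell exprD -mulrA natrX -exprMn mulVf ?pnatr_eq0 // expr1n mulr1.
Qed.

Lemma ell_ge q q' : (q <= q')%N -> ell q' <= ell q.
Proof.
move=> qq; rewrite -(subnKC qq) -(ellD q (q' - q)) ler_peMr ?(ltW (ell_gt0 _))
  //.
by rewrite ler1n expn_gt0.
Qed.

Lemma ell_vol q : vol R n q = ell q ^+ n.
Proof. by rewrite /vol exprM. Qed.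

Lemma ell_small (e : R) : 0 < e -> exists q0, forall q, (q0 <= q)%N -> ell q <
  e.
Proof.
move=> e0; exists (Num.truncn e^-1) => q tq.
rewrite /ell exprVn invf_plt ?posrE ?exprn_gt0 //.
apply: lt_le_trans (truncnS_gt _) _; rewrite -natrX ler_nat.
by apply: leq_ltn_trans tq _; exact: ltn_expl.
Qed.

(** Replaces a radius by a comparable dyadic side; generations start at side 1, whence [r <= 1]. *)
Lemma ell_gen (r : R) : 0 < r -> r <= 1 -> exists q, r <= ell q < 2 * r.
Proof.
move=> r0 r1; have [q0 H0] := ell_small r0.
have ex : exists q, ell q < r by exists q0; exact: H0.
case: (ex_minnP ex) => -[|q]; first by rewrite /ell expr0 ltNge r1.
move=> qr qmin; exists q; rewrite leNgt; apply/andP; split.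
  by apply/negP => /qmin; rewrite ltnn.
by rewrite -(ellD q 1) addn1 mulrC ltr_pM2l.
Qed.

(* Indices are natural numbers, so these cubes only fill the orthant with corner
   [o]; outside of it the coordinates of [loc] are truncated to 0. *)
Definition ccube (C : cub) : set 'rV[R]_n :=
  [set y | forall i, o ord0 i + (C.2 i)%:R * ell C.1 <= y ord0 i
                     <= o ord0 i + (C.2 i).+1%:R * ell C.1].

Definition orthant : set 'rV[R]_n := [set y | forall i, o ord0 i <= y ord0 i].

(** Closed cubes share faces; truncation picks the half-open one, so that each point of the orthant
    has one cell per generation and these cells are nested. *)
Definition loc (q : nat) (y : 'rV[R]_n) : idx :=
  [ffun i => Num.truncn ((y ord0 i - o ord0 i) / ell q)].

(** The lower corner belongs to the half-open cell, so [loc] recovers from it the cube and its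
    ancestors. It is the test point that turns covers of sets into covers of indices. *)
Definition corner (C : cub) : 'rV[R]_n :=
  \row_i (o ord0 i + (C.2 i)%:R * ell C.1).

Lemma in_loc q y : orthant y -> ccube (q, loc q y) y.
Proof.
move=> oy i; rewrite /= ffunE; set t := Num.truncn _.
have /truncn_itv : 0 <= (y ord0 i - o ord0 i) / ell q.
  by rewrite divr_ge0 ?(ltW (ell_gt0 q)) // subr_ge0.
rewrite -/t ler_pdivlMr ?ell_gt0 // ltr_pdivrMr ?ell_gt0 // => /andP[t1 t2].
by rewrite -lerBrDl t1 /= -lerBlDl ltW.
Qed.

Lemma loc_eq q y (z : idx) :
  (forall i, o ord0 i + (z i)%:R * ell q <= y ord0 i
    < o ord0 i + (z i).+1%:R * ell q) -> loc q y = z.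
Proof.
move=> H; apply/ffunP => i; rewrite ffunE; apply: truncn_def.
rewrite ler_pdivlMr ?ell_gt0 // ltr_pdivrMr ?ell_gt0 //.
by have := H i; rewrite lerBrDl ltrBlDl.
Qed.

Lemma anc_loc q k y : orthant y -> anc k (loc (q + k) y) = loc q y.
Proof.
move=> oy; apply/esym/loc_eq => i.
rewrite !ffunE; set t := Num.truncn _.
have /truncn_itv : 0 <= (y ord0 i - o ord0 i) / ell (q + k).
  by rewrite divr_ge0 ?(ltW (ell_gt0 _)) // subr_ge0.
rewrite -/t ler_pdivlMr ?ell_gt0 // ltr_pdivrMr ?ell_gt0 // => /andP[t1 t2].
have E : ell q = (2 ^ k)%:R * ell (q + k) by rewrite mulrC ellD.
rewrite -lerBrDl -ltrBlDl E !mulrA -!natrM; apply/andP; split.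
  apply: le_trans t1; rewrite ler_pM2r ?ell_gt0 // ler_nat.
  exact: leq_divM.
apply: lt_le_trans t2 _; rewrite ler_pM2r ?ell_gt0 // ler_nat.
by rewrite -ltn_divLR // expn_gt0.
Qed.

Lemma corner_orthant C : orthant (corner C).
Proof. by move=> i; rewrite mxE lerDl mulr_ge0 // ltW // ell_gt0. Qed.

Lemma loc_corner C : loc C.1 (corner C) = C.2.
Proof.
by apply: loc_eq => i; rewrite mxE lexx ltrD2l ltr_pM2r ?ell_gt0 // ltr_nat /=.
Qed.

Lemma loc_corner_le C q : (q <= C.1)%N -> loc q (corner C) = anc (C.1 - q) C.2.
Proof.
move=> qC; rewrite -(anc_loc q (C.1 - q) (corner_orthant C)) subnKC //.
by rewrite (loc_corner C).
Qed.

Lemma ccube_corner C : ccube C (corner C).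
Proof.
by move=> i; rewrite mxE lexx lerD2l ler_pM2r ?ell_gt0 // ler_nat /= leqnSn.
Qed.

Lemma ccube_orthant C : ccube C `<=` orthant.
Proof.
move=> y Cy i; have /andP[+ _] := Cy i; apply: le_trans.
by rewrite lerDl mulr_ge0 // ltW // ell_gt0.
Qed.

Lemma ccube_below A P : below A P -> ccube A `<=` ccube P.
Proof.
move=> /andP[PA /eqP AP] y Ay i; have /andP[A1 A2] := Ay i.
have E : ell P.1 = (2 ^ (A.1 - P.1))%:R * ell A.1.
  by rewrite mulrC -[in LHS](ellD P.1 (A.1 - P.1)) subnKC.
rewrite -AP ffunE E !mulrA -!natrM; apply/andP; split.
  apply: le_trans A1; rewrite lerD2l ler_pM2r ?ell_gt0 // ler_nat.
  exact: leq_divM.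
apply: (le_trans A2); rewrite lerD2l ler_pM2r ?ell_gt0 // ler_nat.
by rewrite -ltn_divLR // expn_gt0.
Qed.

Lemma ccube_dist C x y : ccube C x -> ccube C y ->
  eucl_dist x y <= n%:R * ell C.1.
Proof.
move=> Cx Cy; apply: eucl_dist_le_coord => i.
have /andP[x1 x2] := Cx i; have /andP[y1 y2] := Cy i.
by move: x2 y2; rewrite -natr1 mulrDl mul1r ler_norml; lra.
Qed.

Lemma loc_ge q k x y i : `|x ord0 i - y ord0 i| <= k%:R * ell q ->
  (loc q x i <= loc q y i + k.+1)%N.
Proof.
move=> xy; rewrite !ffunE; set a := Num.truncn _; set b := Num.truncn _.
have [x0|x0] := ltP ((x ord0 i - o ord0 i) / ell q) 0.
  suff -> : a = 0%N by [].
  apply/eqP; rewrite -leqn0 /a truncn_le_nat; lra.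
have := truncn_itv x0; rewrite -/a => /andP[ax _].
have bx : (y ord0 i - o ord0 i) / ell q < b.+1%:R by exact: truncnS_gt.
have : (x ord0 i - o ord0 i) / ell q - (y ord0 i - o ord0 i) / ell q <= k%:R.
  rewrite -mulrBl ler_pdivrMr ?ell_gt0 //; apply: le_trans xy.
  by apply: le_trans (ler_norm _); lra.
move=> xyk; rewrite -ltnS -addnS addnC -(ltr_nat R).
have -> : (k.+2 + b)%:R = b.+1%:R + k%:R + 1 :> R.
  by rewrite natrD -[k.+2%:R]natr1 -[k.+1%:R]natr1 -[b.+1%:R]natr1; lra.
lra.
Qed.


End Cubes.

(** * Hausdorff measure and counts of cubes *)

Section Hausdorff.
Context (R : realType) (n : nat).
Implicit Types (s rho : R) (F G : set 'rV[R]_n).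

Lemma hausdorff_content_anti s F (rho rho' : R) : rho <= rho' ->
  (hausdorff_content s rho' F <= hausdorff_content s rho F)%E.
Proof.
move=> le_rho; apply: ereal_inf_le_tmp => _ [D [c [r [[rP FD] ->]]]].
exists D, c, r; split => //; split => // i Di.
by have /andP[-> /= /lt_le_trans ->] := rP i Di.
Qed.

(** The content grows as [rho] decreases, so the limit at 0 is a supremum. *)
Lemma hausdorff_measureE s F : hausdorff_measure s F =
  ereal_sup [set hausdorff_content s rho F | rho in [set rho | 0 < rho]].
Proof.
apply: cvg_lim => //.
have -> : [set rho : R | 0 < rho] = [set` Interval (BRight 0) +oo%O].
  by apply/seteqP; split => x /=; rewrite in_itv /= andbT.
apply: nonincreasing_at_right_cvge => // x y _ _ xy.
exact: hausdorff_content_anti.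
Qed.

Lemma hausdorff_content_le s F (rho : R) : 0 < rho ->
  (hausdorff_content s rho F <= hausdorff_measure s F)%E.
Proof.
by move=> r0; rewrite hausdorff_measureE; apply: ereal_sup_ubound; exists rho.
Qed.

Lemma hausdorff_measure_le s F (M : \bar R) :
  (forall rho : R, 0 < rho -> (hausdorff_content s rho F <= M)%E) ->
  (hausdorff_measure s F <= M)%E.
Proof.
by move=> H; rewrite hausdorff_measureE; apply: ge_ereal_sup => _ [r /H + <-].
Qed.

Lemma hausdorff_measure_subset s F G : F `<=` G ->
  (hausdorff_measure s F <= hausdorff_measure s G)%E.
Proof.
move=> FG; apply: hausdorff_measure_le => rho r0.
apply: le_trans (hausdorff_content_le s G r0).
apply: ereal_inf_le_tmp => _ [D [c [r [[rP GD] ->]]]].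
by exists D, c, r; split => //; split => //; exact: subset_trans GD.
Qed.

End Hausdorff.

Section CubeCover.
Context (R : realType) (n : nat) (o : 'rV[R]_n).
Local Notation cub := (cub n).
Local Notation idx := (idx n).
Local Notation ell := (ell R).
Local Notation vol := (vol R n).

(** A cube of side l has diameter at most n l, hence lies in the open ball of radius [n.+1%:R * l]
    about its corner. The balls are indexed by the [pickle] codes of the cubes, and finite
    subfamilies suffice because [\esum] is a supremum of finite sums. *)
Lemma hausdorff_content_cubes (s rho M : R) (E : set 'rV[R]_n) (T : set cub) :
  (forall y, E y -> orthant o y /\ exists q, T (q, loc o q y)) ->
  (forall C, T C -> n.+1%:R * ell C.1 < rho) ->
  (forall l : seq cub, uniq l -> (forall C, C \in l -> T C) ->
     \sum_(C <- l) (n.+1%:R * ell C.1) `^ s <= M) ->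
  (hausdorff_content s rho E <= M%:E)%E.
Proof.
move=> ET Trho TM.
(* A default value for numbers that code no cube; they lie outside the index set of the cover. *)
pose c0 : cub := (0%N, [ffun=> 0%N]).
pose dec i : cub := odflt c0 (choice.unpickle i).
pose r i : R := n.+1%:R * ell (dec i).1.
apply: ge_ereal_inf; exists (\esum_(i in choice.pickle @` T) (r i `^ s)%:E)%E.
  exists (choice.pickle @` T), (fun i => corner o (dec i)), r; split => //;
    split.
    move=> _ [C TC <-]; rewrite /r /dec choice.pickleK /= Trho // andbT.
    by rewrite mulr_gt0 // ell_gt0.
  move=> y /ET[oy [q Tq]]; exists (choice.pickle ((q, loc o q y) : cub)).
    by exists (q, loc o q y).
  rewrite /eucl_ball /r /dec choice.pickleK /=.
  apply: le_lt_trans (ccube_dist (ccube_corner o (q, loc o q y)) (in_loc q oy))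
    _.
  by rewrite ltr_pM2r ?ell_gt0 // ltr_nat.
rewrite (@reindex_esum _ _ _ T _ choice.pickle); last first.
  by split => // C C' _ _ /(pcan_inj choice.pickleK).
apply: ge_ereal_sup => _ [A [finA AT] <-].
rewrite fsbig_finite //= sumEFin lee_fin.
rewrite (eq_bigr (fun C : cub => (n.+1%:R * ell C.1) `^ s)); last first.
  by move=> C _; rewrite /r /dec choice.pickleK.
apply: TM; first exact: finmap.fset_uniq.
by move=> C; rewrite in_fset_set // inE => /AT.
Qed.

Definition hereditary (S : pred cub) : Prop :=
  forall A P, below A P -> S P -> S A.

(** A total volume, not normalised by the volume of [P]. *)
Definition dens (S : pred cub) (P : cub) (m : nat) : R :=
  vol m * (count (fun z => S (m, z)) (desc (m - P.1) P.2))%:R.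

Lemma dens_le (S : pred cub) P m m' : hereditary S -> (P.1 <= m <= m')%N ->
  dens S P m <= dens S P m'.
Proof.
move=> hS /andP[Pm mm']; rewrite /dens.
have -> : (m' - P.1 = (m - P.1) + (m' - m))%N by lia.
have /permP -> := desc_flatten (m - P.1) (m' - m) P.2.
rewrite count_flatten -map_comp sumnE big_map.
have -> : vol m = vol m' * (2 ^ ((m' - m) * n))%:R by rewrite -{1}(subnKC mm')
  volD.
rewrite -mulrA -natrM ler_pM2l ?vol_gt0 // ler_nat.
rewrite -sum1_count big_mkcond big_distrr /=; apply: leq_sum => z _.
case: ifP => Sz; last by rewrite muln0.
rewrite muln1 -(size_desc (m' - m) z) -count_predT.
rewrite [leqLHS](@eq_in_count _ _ (fun w => S (m', w))) //= => w.
rewrite mem_desc => wz; apply/esym; apply: hS Sz.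
by rewrite /below /= mm'.
Qed.

(** [E] is covered by the maximal cubes of [S] among those fine enough for [rho]. They are disjoint,
    so finitely many of them, subdivided to a common generation [m], have total volume at most
    [dens S P m]. *)
Lemma hausdorff_measure_le_dens (S : pred cub) (P : cub) (E : set 'rV[R]_n) (T :
  R) :
  hereditary S ->
  (forall y, E y -> [/\ orthant o y, loc o P.1 y = P.2 &
     exists2 m, (P.1 <= m)%N & S (m, loc o m y)]) ->
  (forall m, (P.1 <= m)%N -> dens S P m <= T) ->
  (hausdorff_measure n%:R E <= (n.+1%:R ^+ n * T)%:E)%E.
Proof.
move=> hS HE HT; apply: hausdorff_measure_le => rho rho0.
have [q0 Hq0] : exists q0, forall q, (q0 <= q)%N -> ell q < rho / n.+1%:R.
  by apply: ell_small; rewrite divr_gt0.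
pose m0 := maxn q0 P.1.
pose T1 : set cub := [set C | [/\ (m0 <= C.1)%N, below C P, S C &
  forall C', below C C' -> S C' -> (m0 <= C'.1)%N -> C' = C]].
have T1_inj (z C C' : cub) : below z C -> below z C' -> T1 C -> T1 C' -> C = C'.
  move=> zC zC' [C1 C2 C3 C4] [C'1 C'2 C'3 C'4].
  have [le|/ltnW le] := leqP C.1 C'.1.
    by apply: C'4 => //; exact: below_cmp zC zC' le.
  by apply/esym/C4 => //; exact: below_cmp zC' zC le.
apply: (hausdorff_content_cubes (T := T1)).
- move=> y /HE[oy yP [m Pm Sm]]; split => //.
  have ex : exists q, (m0 <= q)%N && S (q, loc o q y).
    exists (maxn m m0); rewrite leq_maxr; apply: hS Sm.
    by rewrite /below /= leq_maxl -(anc_loc m (maxn m m0 - m) oy) subnKC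
      ?leq_maxl ?eqxx.
  have locb q q' : (q <= q')%N -> below (q', loc o q' y) (q, loc o q y).
    by move=> qq'; rewrite /below /= qq' -(anc_loc q (q' - q) oy) subnKC ?eqxx.
  case: (ex_minnP ex) => q /andP[mq Sq] qmin; exists q; split => //.
    rewrite [P]surjective_pairing -yP; apply: locb.
    exact: leq_trans (leq_maxr _ _) mq.
  move=> C' bC' SC' mC'; have C'q := below_gen bC'.
  have C'E : C' = (C'.1, loc o C'.1 y) by exact: below_eq bC' (locb _ _ C'q)
    erefl.
  suff qC' : C'.1 = q by rewrite C'E qC'.
  by apply/eqP; rewrite eqn_leq C'q /=; apply: qmin; rewrite mC' -C'E.
- move=> C [mC _ _ _]; rewrite mulrC -ltr_pdivlMr //; apply: Hq0.
  exact: leq_trans (leq_maxl _ _) mC.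
move=> l ul lT.
rewrite (eq_bigr (fun C : cub => n.+1%:R ^+ n * vol C.1)); last first.
  move=> C _; rewrite powR_mulrn ?mulr_ge0 ?(ltW (ell_gt0 _ _)) //.
  by rewrite exprMn ell_vol.
rewrite -mulr_sumr ler_wpM2l //.
pose m := maxn (\max_(C <- l) C.1) P.1.
have lm C : C \in l -> (C.1 <= m)%N.
  by move=> Cl; rewrite (leq_trans _ (leq_maxl _ _)) // (big_rem C) //=
    leq_maxl.
apply: (@le_trans _ _ (dens S P m)); last by apply: HT; exact: leq_maxr.
pose Z := [seq z <- desc (m - P.1) P.2 | S (m, z)].
apply: (@le_trans _ _ (\sum_(z <- Z) vol m)); last first.
  by rewrite /dens -size_filter big_const_seq count_predT iter_addr_0 mulr_natr
    lexx.
apply: le_trans (sum_fibers_le (r := fun z C => below (m, z) C && `[< T1 C >])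
  ul (fun _ _ => ltW (vol_gt0 R n m)) _); last first.
  by move=> z C C' /andP[zC /asboolP TC] /andP[zC' /asboolP TC'];
    exact: T1_inj zC zC' TC TC'.
rewrite big_seq [leRHS]big_seq; apply: ler_sum => C Cl.
have TC := lT C Cl; have Cm := lm C Cl; have [_ CP SC _] := TC.
rewrite -big_filter -[X in X <= _](sum_vol R (m - C.1) C.2) subnKC //.
rewrite le_eqVlt; apply/orP; left; apply/eqP; apply: perm_big.
apply: uniq_perm; rewrite ?filter_uniq ?desc_uniq // => z.
rewrite !mem_filter (asboolT TC) andbT mem_desc.
have -> : below (m, z) C = (anc (m - C.1) z == C.2) by rewrite /below Cm.
case: eqP => //= zC; have bz : below (m, z) C by rewrite /below Cm zC eqxx.
have : below (m, z) P by exact: below_trans CP.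
by rewrite belowE (hS _ _ bz SC) /= => /andP[].
Qed.

Lemma dens_gt (S : pred cub) (P : cub) (E : set 'rV[R]_n) (T : R) :
  hereditary S ->
  (forall y, E y -> [/\ orthant o y, loc o P.1 y = P.2 &
     exists2 m, (P.1 <= m)%N & S (m, loc o m y)]) ->
  ((n.+1%:R ^+ n * T)%:E < hausdorff_measure n%:R E)%E ->
  exists2 m, (P.1 <= m)%N & T < dens S P m.
Proof.
move=> hS HE; rewrite ltNge => /negP HT; apply: contrapT => nex; apply: HT.
apply: hausdorff_measure_le_dens hS HE _ => m Pm; rewrite leNgt.
by apply/negP => Tm; apply: nex; exists m.
Qed.

End CubeCover.

(** * From ball covers to finite lists of cubes *)

Section BallCover.
Context (R : realType) (n : nat) (o : 'rV[R]_n).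
Local Notation cub := (cub n).
Local Notation idx := (idx n).
Local Notation ell := (ell R).
Local Notation vol := (vol R n).

(** In each coordinate the ball has width at most two sides, and four consecutive indices starting
    at that of [x - r] are enough. *)
Lemma eucl_ball_cubes (x : 'rV[R]_n) (r : R) (q : nat) : r <= ell q ->
  exists2 Z : seq idx, size Z = (4 ^ n)%N &
    forall y, orthant o y -> eucl_ball x r y -> loc o q y \in Z.
Proof.
move=> rq; pose w : 'rV[R]_n := \row_i (x ord0 i - r).
exists [seq [ffun i => loc o q w i + v i]%N | v : {ffun 'I_n -> 'I_4}].
  by rewrite size_map -cardT card_ffun !card_ord.
move=> y oy /= xy.
have yw i : (loc o q w i <= loc o q y i <= loc o q w i + 3)%N.
  have := le_lt_trans (coord_le_eucl_dist x y i) xy;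
    rewrite ltr_norml => /andP[h1 h2].
  apply/andP; split.
    rewrite !ffunE; apply: le_truncn;
      rewrite ler_pM2r ?invr_gt0 ?ell_gt0 // mxE; lra.
  apply: loc_ge; rewrite mxE ler_norml; apply/andP; split; lra.
apply/mapP; exists [ffun i => inord (loc o q y i - loc o q w i)%N].
  by rewrite mem_enum.
apply/ffunP => i; rewrite !ffunE inordK; last by have := yw i; rewrite !ffunE;
  lia.
by have := yw i; rewrite !ffunE; lia.
Qed.

Lemma ccube_compact (C : cub) : compact (ccube o C).
Proof.
have -> : ccube o C = [set v | forall i,
    `[o ord0 i + (C.2 i)%:R * ell C.1, o ord0 i + (C.2 i).+1%:R * ell
      C.1]%classic
      (v ord0 i)].
  by apply/seteqP; split => y Cy i; have := Cy i; rewrite /= in_itv.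
by apply: (@rV_compact _ _ (fun i => `[o ord0 i + (C.2 i)%:R * ell C.1,
  o ord0 i + (C.2 i).+1%:R * ell C.1]%classic)) => i; exact: segment_compact.
Qed.

Definition cubes_union (g : nat) (X : seq idx) : set 'rV[R]_n :=
  [set y | exists2 z, z \in X & ccube o (g, z) y].

Lemma cubes_union_compact g X : compact (cubes_union g X).
Proof.
elim: X => [|z X IH].
  have -> : cubes_union g [::] = set0 by apply/seteqP; split => // y [].
  exact: compact0.
have -> : cubes_union g (z :: X) = ccube o (g, z) `|` cubes_union g X.
  apply/seteqP; split => y.
    move=> [w]; rewrite inE => /orP[/eqP -> zy|wX wy]; first by left.
    by right; exists w.
  move=> [zy|[w wX wy]]; first by exists z; rewrite ?mem_head.
  by exists w => //; rewrite inE wX orbT.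
by apply: compactU => //; exact: ccube_compact.
Qed.

(** The balls cover the intersection of the [K N]; together with the complements of the [K N] they
    form an open cover of the compact [K 0]. In a finite subcover let [N0] be the largest index of a
    complement: [K N0] meets none of these complements, so finitely many balls cover it. Each ball
    of radius r is then replaced by [4 ^ n] cells of side between r and 2 r. *)
Lemma ball_cover_cubes (sigma rho : R) (K : nat -> set 'rV[R]_n)
    (E : set 'rV[R]_n) D c r :
  0 < sigma -> rho <= 1 ->
  (forall N, compact (K N)) -> (forall N, K N.+1 `<=` K N) ->
  K 0%N `<=` orthant o -> \bigcap_N K N `<=` E -> is_ball_cover rho E D c r ->
  exists N0 (s : seq cub), [/\ forall A, A \in s -> ell A.1 < 2 * rho,
    forall y, K N0 y -> exists2 A, A \in s & loc o A.1 y = A.2 &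
    ((\sum_(A <- s) ell A.1 `^ sigma)%:E <=
      ((4 ^+ n * 2 `^ sigma)%:E * \esum_(i in D) (r i `^ sigma)%:E))%E].
Proof.
move=> sg0 rho1 cK KS Ko KE [rP ED].
have Kle N N' : (N <= N')%N -> K N' `<=` K N.
  move=> /subnKC <-; elim: (N' - N)%N => [|k IH]; first by rewrite addn0.
  by rewrite addnS; exact: subset_trans (KS _) IH.
have /choice[q Hq] : forall i, exists q, D i -> r i <= ell q < 2 * r i.
  move=> i; have [Di|nDi] := pselect (D i); last by exists 0%N.
  have /andP[r0 r1] := rP i Di.
  by have [|q Hq] := ell_gen r0; [exact: le_trans (ltW r1) rho1|exists q].
have /choice[Z HZ] : forall i, exists Z : seq idx, D i -> size Z = (4 ^ n)%N /\
    forall y, orthant o y -> eucl_ball (c i) (r i) y -> loc o (q i) y \in Z.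
  move=> i; have [Di|nDi] := pselect (D i); last by exists [::].
  have [|Z Z1 Z2] := @eucl_ball_cubes (c i) (r i) (q i);
    first by case/andP: (Hq i Di).
  by exists Z.
pose f (k : nat + nat) : set 'rV[R]_n :=
  match k with inl i => eucl_ball (c i) (r i) | inr N => ~` K N end.
pose DD : set (nat + nat) := [set k | if k is inl i then D i else True].
have : cover_compact (K 0%N) by rewrite -compact_cover; exact: cK.
move=> /(_ _ DD f)[].
- move=> [i|N] _ /=; first exact: open_eucl_ball.
  apply: closed_openC; apply: compact_closed (cK N).
  exact: norm_hausdorff.
- move=> y Ky; have [Ey|nKy] := pselect (forall N, K N y).
    have [i Di iy] := ED y (KE y (fun N _ => Ey N)).
    by exists (inl i).
  have [N nN] : exists N, ~ K N y by apply: contrapT => nex; apply: nKy => N;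
    apply: contrapT => nK; apply: nex; exists N.
  by exists (inr N).
move=> F0 FD0 KF0; pose F : seq (nat + nat) := finmap.enum_fset F0.
have FD k : k \in F -> DD k by move=> kF; have := FD0 k kF; rewrite inE.
have KF y : K 0%N y -> exists2 k, k \in F & f k y.
  by move=> /KF0[k kF fk]; exists k.
pose N0 := \max_(k <- F) (if k is inr N then N else 0%N).
pose L := undup (pmap (fun k : nat + nat => if k is inl i then Some i else None)
  F).
have LP i : (i \in L) = (inl i \in F).
  rewrite mem_undup mem_pmap; apply/mapP/idP => [[[j|//] jF [->]]//|iF].
  by exists (inl i).
have LD i : i \in L -> D i by rewrite LP => /FD.
exists N0, (flatten [seq [seq (q i, z) | z <- Z i] | i <- L]); split.
- move=> A /flattenP[_ /mapP[i /LD Di ->] /mapP[z _ ->]] /=.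
  have /andP[_ h1] := Hq i Di; have /andP[_ h2] := rP i Di.
  by apply: lt_trans h1 _; rewrite ltr_pM2l.
- move=> y Ky; have [|[i|N] kF /=] := KF y; first exact: Kle Ky.
    have iL : i \in L by rewrite LP.
    move=> iy; exists (q i, loc o (q i) y) => //.
    apply/flattenP; exists [seq (q i, z) | z <- Z i]; first exact: map_f.
    apply: map_f; have [_] := HZ i (LD i iL); apply => //.
    by apply: Ko; exact: Kle Ky.
  case; apply: Kle Ky; rewrite /N0 (big_rem (inr N)) //=; exact: leq_maxl.
rewrite big_flatten big_map /=.
apply: (@le_trans _ _ ((4 ^+ n * 2 `^ sigma)%:E * (\sum_(i <- L) r i `^
  sigma)%:E)%E).
  rewrite -EFinM lee_fin mulr_sumr big_seq [leRHS]big_seq;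
    apply: ler_sum => i iL.
  have Di := LD i iL.
  rewrite big_map /= big_const_seq count_predT iter_addr_0 (HZ i Di).1.
  rewrite -[leLHS]mulr_natl natrX -mulrA ler_pM2l ?exprn_gt0 //.
  have /andP[r0 _] := rP i Di; have /andP[_ h] := Hq i Di.
  rewrite -powRM ?(ltW r0) //; apply: ge0_ler_powR;
    rewrite ?(ltW sg0) ?nnegrE //.
  - exact/ltW/ell_gt0.
  - by rewrite mulr_ge0 // ltW.
  - exact: ltW.
apply: lee_wpmul2l; first by rewrite lee_fin mulr_ge0 ?exprn_ge0 ?powR_ge0.
apply: esum_ge; exists [set` L].
  by split => [|i /LD]; first exact: finite_seq.
by rewrite -fsbig_seq ?undup_uniq //= sumEFin.
Qed.

(** Double counting of cells of generation [M]: those inside a cube have total volume at most that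
    of the cube, and a cube finer than [M] contains none. *)
Lemma cover_vol (M : nat) (Y : seq idx) (s : seq cub) : uniq Y ->
  (forall y, y \in Y -> has (below (M, y)) s) ->
  vol M * (size Y)%:R <= \sum_(A <- s) vol A.1.
Proof.
move=> uY Ys.
apply: (@le_trans _ _ (\sum_(A <- s) \sum_(y <- Y | below (M, y) A) vol M));
  last first.
  apply: ler_sum => A _; rewrite big_const_seq iter_addr_0.
  have [AM|AM] := leqP A.1 M; last first.
    rewrite (eq_count (a2 := pred0)) ?count_pred0 ?mulr0n ?(ltW (vol_gt0 _ _ _))
      //.
    by move=> y; rewrite /below /= leqNgt AM.
  rewrite -[leRHS](volD R n A.1 (M - A.1)) subnKC // -[leLHS]mulr_natr.
  rewrite ler_pM2l ?vol_gt0 // ler_nat -(size_desc (M - A.1) A.2) -size_filter.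
  apply: uniq_leq_size; first exact: filter_uniq.
  by move=> y; rewrite mem_filter belowE => /andP[/andP[]].
under eq_bigr do rewrite big_mkcond.
rewrite exchange_big /= -sum1_size natr_sum mulr_sumr big_seq [leRHS]big_seq.
apply: ler_sum => y /Ys/hasP[A As yA]; rewrite mulr1 (big_rem A) //= yA lerDl.
by apply: sumr_ge0 => B _; case: ifP => // _; exact/ltW/vol_gt0.
Qed.

(** [ball_cover_cubes] for a constant family and exponent [n], where [4 ^ n * 2 ^ n = 8 ^ n].
    Testing on corners at a generation [M] finer than all cubes involved reduces the bound to
    [cover_vol]. *)
Lemma hausdorff_measure_ge_cubes (g : nat) (X : seq idx) (E : set 'rV[R]_n) :
  (0 < n)%N -> uniq X -> (forall z, z \in X -> ccube o (g, z) `<=` E) ->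
  (((8 ^+ n)^-1 * (vol g * (size X)%:R))%:E <= hausdorff_measure n%:R E)%E.
Proof.
move=> n0 uX XE; apply: le_trans (hausdorff_content_le n%:R E ltr01).
apply: le_ereal_inf_tmp => _ [D [c [r [cov ->]]]].
have [||||||N0 [s [s1 s2 s3]]] := @ball_cover_cubes n%:R 1
  (fun=> cubes_union g X) E D c r _ _ _ _ _ _ cov => //.
- by rewrite ltr0n.
- by move=> _; exact: cubes_union_compact.
- by move=> _ y.
- by move=> y [z _ zy]; exact: ccube_orthant zy.
- by move=> y /(_ 0%N I)[z zX zy]; exact: XE zX y zy.
pose M := maxn g (\max_(A <- s) A.1).
have sM A : A \in s -> (A.1 <= M)%N.
  by move=> As; rewrite (leq_trans _ (leq_maxr _ _)) // (big_rem A) //=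
    leq_maxl.
have gM : (g <= M)%N by exact: leq_maxl.
pose Y := flatten [seq desc (M - g) z | z <- X].
have uY : uniq Y by exact: uniq_flatten_desc.
have szY : vol M * (size Y)%:R = vol g * (size X)%:R.
  rewrite size_flatten /shape -map_comp sumnE big_map.
  under eq_bigr do rewrite /= size_desc.
  rewrite big_const_seq count_predT iter_addn_0 natrM mulrA.
  by rewrite -[in LHS](subnKC gM) addKn volD.
have Ys y : y \in Y -> has (below (M, y)) s.
  move=> /flattenP[_ /mapP[z zX ->]] yz.
  have [|A As lA] := s2 (corner o (M, y)).
    exists z => //; apply: ccube_below (ccube_corner o (M, y)).
    by rewrite belowE gM.
  apply/hasP; exists A => //; rewrite /below /= sM // -lA.
  by rewrite (loc_corner_le o (C := (M, y))) //= sM.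
have := cover_vol uY Ys; rewrite szY.
rewrite (eq_bigr (fun A : cub => ell A.1 `^ n%:R)) => [le1|A _]; last first.
  by rewrite powR_mulrn ?ell_vol // ltW // ell_gt0.
have e8 : 4 ^+ n * 2 `^ n%:R = 8 ^+ n :> R.
  by rewrite powR_mulrn // -exprMn; congr (_ ^+ _); lra.
rewrite EFinM lee_pdivrMl ?exprn_gt0 // -e8.
by apply: le_trans s3; rewrite lee_fin.
Qed.

End BallCover.

(** * Rich cubes from the local scaling property *)

Lemma size_flatten_map (I : Type) (J : eqType) (t : seq I) (f : I -> seq J) :
  size (flatten [seq f i | i <- t]) = (\sum_(i <- t) size (f i))%N.
Proof. by rewrite size_flatten /shape -map_comp sumnE big_map. Qed.

Lemma ccube_sub_ball (R : realType) (n : nat) (o y : 'rV[R]_n) (e : R) m :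
  n.+1%:R * ell R m <= e -> orthant o y ->
  ccube o (m, loc o m y) `<=` eucl_ball y e.
Proof.
move=> me oy w Cw; apply: lt_le_trans me.
apply: le_lt_trans (ccube_dist (in_loc m oy) Cw) _ => /=.
by rewrite ltr_pM2r ?ell_gt0 // ltr_nat.
Qed.

Lemma ccube_in_ball (R : realType) (n : nat) (o : 'rV[R]_n) (y : 'rV[R]_n) (e :
  R) m0 :
  0 < e -> orthant o y -> exists2 m, (m0 <= m)%N & ccube o (m, loc o m y) `<=`
    eucl_ball y e.
Proof.
move=> e0 oy; have n1 : 0 < n.+1%:R :> R by [].
have [q Hq] := ell_small (divr_gt0 e0 n1).
exists (maxn q m0); first exact: leq_maxr.
by apply: ccube_sub_ball oy;
  rewrite mulrC -ler_pdivlMr // ltW // Hq // leq_maxl.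
Qed.

Lemma eucl_ball_sub (R : realType) (n : nat) (x y : 'rV[R]_n) (r : R) :
  eucl_ball y (r - eucl_dist x y) `<=` eucl_ball x r.
Proof.
move=> z yz; apply: le_lt_trans (eucl_distD x y z) _.
by move: yz; rewrite /eucl_ball /=; lra.
Qed.

Lemma nbhd_set_sub (R : realType) (n : nat) (F : set 'rV[R]_n) (u : R) y :
  nbhd_set F u y -> exists2 e, 0 < e & eucl_ball y e `<=` nbhd_set F u.
Proof.
move=> /nbhd_setP[x Fx yx]; exists (u - eucl_dist x y).
  by rewrite subr_gt0 eucl_distC.
by move=> z /eucl_ball_sub xz; apply/nbhd_setP; exists x => //;
  rewrite eucl_distC.
Qed.

Section LSP.
Context (R : realType) (n : nat) (o : 'rV[R]_n).
Context (F : nat -> set 'rV[R]_n) (Upsilon : nat -> R) (k s c3 c4 r1 : R).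
Hypotheses (n_gt0 : (0 < n)%N) (k_lt_s : k < s) (s_lt_n : s < n%:R).
Hypotheses (c3_gt0 : 0 < c3) (c4_gt0 : 0 < c4).
Hypothesis lsp_ge : forall (r delta : R) j x, 0 < r -> r < r1 ->
  0 <= delta -> delta < r -> F j x ->
  ((c3 * (delta `^ (n%:R - k) * r `^ k))%:E <=
   hausdorff_measure n%:R (eucl_ball x r `&` nbhd_set (F j) delta))%E.
Hypothesis lsp_le : forall (r delta : R) j x, 0 < r -> r < r1 ->
  0 <= delta -> delta < r -> F j x ->
  (hausdorff_measure n%:R (eucl_ball x r `&` nbhd_set (F j) delta)
    <= (c4 * (delta `^ (n%:R - k) * r `^ k))%:E)%E.
Local Notation cub := (cub n).
Local Notation idx := (idx n).
Local Notation ell := (ell R).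
Local Notation vol := (vol R n).

Definition cst (q : nat) : R := ell q `^ s.

Lemma cst_gt0 q : 0 < cst q.
Proof. by rewrite powR_gt0 // ell_gt0. Qed.

Lemma cst_ge0 q : 0 <= cst q.
Proof. exact/ltW/cst_gt0. Qed.

Lemma vol_cst q : vol q = cst q * ell q `^ (n%:R - s).
Proof.
rewrite ell_vol -powR_mulrn ?(ltW (ell_gt0 _ _)) // /cst -powRD.
  by congr (_ `^ _); ring.
by apply/implyP => _; rewrite gt_eqF // ell_gt0.
Qed.

Definition lsp_const : R := 1 + 8 ^+ n * c4 * n.+1%:R `^ k.

Lemma lsp_const_gt0 : 0 < lsp_const.
Proof. by rewrite ltr_pwDl // !mulr_ge0 ?powR_ge0 ?(ltW c4_gt0) ?exprn_ge0. Qed.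

(** Limits the volume of Delta(F_j,u) that one cube [A] of a cover can take, in terms of its cost.
    With l the side of [A]: if l < u, the volume is l^s l^(n-s) <= l^s u^(n-s); if u <= l, the LSP
    gives a multiple of u^(n-k) l^k = u^(n-s) u^(s-k) l^k <= u^(n-s) l^s. *)
Lemma lsp_count_le (u : R) j (A : cub) g (X : seq idx) :
  0 < u -> n.+1%:R * ell A.1 < r1 -> uniq X ->
  (forall z, z \in X -> below (g, z) A /\ ccube o (g, z) `<=` nbhd_set (F j) u)
    ->
  vol g * (size X)%:R <= lsp_const * u `^ (n%:R - s) * cst A.1.
Proof.
move=> u0 Ar1 uX HX; have l0 := ell_gt0 R A.1.
have pos : 0 <= lsp_const * u `^ (n%:R - s) * cst A.1.
  by rewrite !mulr_ge0 ?powR_ge0 ?cst_ge0 ?(ltW lsp_const_gt0).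
case EX : X => [|z0 X0]; first by rewrite mulr0.
rewrite -EX; have z0X : z0 \in X by rewrite EX mem_head.
have [z0A z0F] := HX _ z0X.
(* Below the scale [u] the volume of [A] suffices; above it, the LSP is needed. *)
have [lu|ul] := ltP (ell A.1) u.
  apply: (@le_trans _ _ (u `^ (n%:R - s) * cst A.1)).
    apply: (@le_trans _ _ (vol A.1)).
      have -> : vol A.1 = \sum_(B <- [:: A]) vol B.1 by rewrite big_seq1.
      by apply: cover_vol => // y /HX[yA _]; rewrite /= yA.
    rewrite vol_cst mulrC ler_wpM2r ?cst_ge0 //; apply: ge0_ler_powR.
    - by rewrite subr_ge0 ltW.
    - by rewrite nnegrE ltW.
    - by rewrite nnegrE ltW.
    - exact: ltW.
  rewrite -mulrA ler_peMl ?mulr_ge0 ?powR_ge0 //.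
  by rewrite lerDl !mulr_ge0 ?powR_ge0 ?(ltW c4_gt0) ?exprn_ge0.
have /nbhd_setP[x Fx zx] := z0F _ (ccube_corner o (g, z0)).
have zA : ccube o A (corner o (g, z0)) by apply: (ccube_below z0A);
  exact: ccube_corner.
(* The point [x] is within [u], at most the side of [A], of a corner in [A], and [A] has diameter at
   most [n] sides; hence the radius of [n.+1] sides. *)
have XE z : z \in X -> ccube o (g, z) `<=`
    eucl_ball x (n.+1%:R * ell A.1) `&` nbhd_set (F j) u.
  move=> zX y Cy; have [bz zF] := HX _ zX; split; last exact: zF.
  have := ccube_dist zA (ccube_below bz Cy).
  have := eucl_distD x (corner o (g, z0)) y.
  rewrite eucl_distC in zx; rewrite /eucl_ball /= -natr1 mulrDl mul1r.
  lra.
have := hausdorff_measure_ge_cubes n_gt0 uX XE.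
have rA0 : 0 < n.+1%:R * ell A.1 by rewrite mulr_gt0.
have urA : u < n.+1%:R * ell A.1.
  by apply: le_lt_trans ul _; rewrite ltr_pMl // ltr1n.
move=> /le_trans/(_ (lsp_le rA0 Ar1 (ltW u0) urA Fx)); rewrite lee_fin.
rewrite ler_pdivrMl ?exprn_gt0 // => /le_trans; apply.
rewrite powRM ?(ltW l0) //.
have E1 : u `^ (n%:R - k) = u `^ (n%:R - s) * u `^ (s - k).
  by rewrite -powRD ?(gt_eqF u0) ?implybT //; congr (_ `^ _); ring.
have E2 : cst A.1 = ell A.1 `^ (s - k) * ell A.1 `^ k.
  by rewrite -powRD ?(gt_eqF l0) ?implybT //; congr (_ `^ _); ring.
have usk : u `^ (s - k) <= ell A.1 `^ (s - k).
  by apply: ge0_ler_powR; rewrite ?nnegrE ?subr_ge0 // ltW.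
rewrite E1 E2.
have -> : 8 ^+ n * (c4 * (u `^ (n%:R - s) * u `^ (s - k) *
    (n.+1%:R `^ k * ell A.1 `^ k))) =
  (8 ^+ n * c4 * n.+1%:R `^ k) * u `^ (n%:R - s) * (u `^ (s - k) * ell A.1 `^
    k).
  by ring.
have lC : 8 ^+ n * c4 * n.+1%:R `^ k <= lsp_const by rewrite /lsp_const lerDr.
apply: ler_pM.
- by rewrite !mulr_ge0 ?powR_ge0 ?(ltW c4_gt0) ?exprn_ge0.
- by rewrite mulr_ge0 ?powR_ge0.
- by rewrite ler_wpM2r ?powR_ge0.
- by rewrite ler_wpM2r ?powR_ge0.
Qed.

Definition target (j0 : nat) : pred cub := fun C =>
  `[< ccube o C `<=` \bigcup_(j in [set j | (j0 <= j)%N]) nbhd_set (F j)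
    (Upsilon j) >].

(** In the denominator, [2 * n.+1%:R ^+ n] is lost in [dens_gt] (the 2 gives a strict inequality),
    [4 ^+ n] in choosing the best cell, [lsp_const] in [lsp_count_le], and [2 ^+ n] because the
    chosen cube may have side up to 2 r. *)
Definition rich_const : R :=
  c3 / (2 * n.+1%:R ^+ n * 4 ^+ n * lsp_const * 2 ^+ n).

Lemma rich_const_gt0 : 0 < rich_const.
Proof.
by rewrite divr_gt0 // !mulr_gt0 ?exprn_gt0 ?lsp_const_gt0.
Qed.

(** The lower LSP bound provides cells of B(x,r) and Delta(F_j,u) of total volume of order u^(n-k)
    r^k, and [lsp_count_le] limits what each cube of a cover takes from them. After division by
    u^(n-s) there remains u^(s-k) r^k, which is theta^(k-n) r^n by the choice of r. *)
Lemma rich_cube (j : nat) (x : 'rV[R]_n) (theta r : R) (P : cub) :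
  let u := Upsilon j in
  0 < theta -> F j x -> 0 < u -> u < r -> u `^ (s - k) = (r / theta) `^ (n%:R -
    k) ->
  r <= 1 -> n.+1%:R * (2 * r) < r1 -> 2 * r <= ell P.1 ->
  (forall y, eucl_ball x r y -> orthant o y /\ loc o P.1 y = P.2) ->
  exists Q : cub, [/\ below Q P, r <= ell Q.1 < 2 * r,
    exists2 y, eucl_ball x r y & loc o Q.1 y = Q.2 &
    forall j0, (j0 <= j)%N ->
      cap cst (target j0) Q (rich_const * theta `^ (- (n%:R - k)) * vol Q.1)].
Proof.
move=> u theta0 Fx u0 ur uE r_le1 rr1 rP ballP.
have r0 : 0 < r by exact: lt_trans ur.
have rltr1 : r < r1.
  apply: le_lt_trans rr1; rewrite mulrA ler_peMl ?(ltW r0) //.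
  by rewrite -natrM ler1n.
have [q /andP[rq qr]] := ell_gen r0 r_le1.
have Pq : (P.1 <= q)%N.
  rewrite leqNgt; apply/negP => /ltnW/(ell_ge R) h.
  by have := lt_le_trans qr rP; rewrite ltNge h.
pose S : pred cub := fun C =>
  `[< ccube o C `<=` eucl_ball x r `&` nbhd_set (F j) u >].
have hS : hereditary S.
  move=> A B AB /asboolP SB; apply/asboolP.
  exact: subset_trans (ccube_below AB) SB.
pose T : R := c3 * (u `^ (n%:R - k) * r `^ k) / (2 * n.+1%:R ^+ n).
have T0 : 0 < T.
  by rewrite divr_gt0 ?mulr_gt0 ?exprn_gt0 // powR_gt0.
have [g Pg Tg] : exists2 g, (P.1 <= g)%N & T < dens R S P g.
  apply: (dens_gt (o := o) (E := eucl_ball x r `&` nbhd_set (F j) u)) => //.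
    move=> y [xy Fy]; have [oy yP] := ballP y xy; split => //.
    have [e e0 He] := nbhd_set_sub Fy.
    have e1 : 0 < Num.min e (r - eucl_dist x y).
      by rewrite lt_min e0 subr_gt0.
    have [m Pm Hm] := ccube_in_ball P.1 e1 oy.
    exists m => //; apply/asboolP => z /Hm;
      rewrite /eucl_ball /= lt_min => /andP[h1 h2].
    by split; [exact: (eucl_ball_sub (y := y))|exact: He].
  apply: lt_le_trans (lsp_ge r0 rltr1 (ltW u0) ur Fx); rewrite lte_fin.
  have a0 : 0 < c3 * (u `^ (n%:R - k) * r `^ k) by rewrite !mulr_gt0 ?powR_gt0.
  have -> : n.+1%:R ^+ n * T = (c3 * (u `^ (n%:R - k) * r `^ k)) / 2.
    have N0 : n.+1%:R ^+ n != 0 :> R by rewrite expf_neq0.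
    by rewrite /T; move: N0; set N := _ ^+ n => N0; set a := c3 * _; field.
  lra.
have {}Tg g' : (g <= g')%N -> T < dens R S P g'.
  by move=> gg'; apply: lt_le_trans Tg _; apply: dens_le => //; rewrite Pg.
have [Z szZ HZ] := eucl_ball_cubes o x rq.
pose g1 := maxn g q.
have qg1 : (q <= g1)%N by exact: leq_maxr.
have S_loc g' z h : (h <= g')%N -> S (g', z) ->
    [/\ orthant o (corner o (g', z)), eucl_ball x r (corner o (g', z)) &
       loc o h (corner o (g', z)) = anc (g' - h) z].
  move=> hg /asboolP/(_ _ (ccube_corner o (g', z)))[cx _].
  by rewrite (loc_corner_le o (C := (g', z))) //; split => //;
    exact: corner_orthant.
(* The ball meets at most [4 ^ n] cubes of its own size: take the best of them. *)
have [w wZ Tw] : exists2 w, w \in Z & T / 4 ^+ n < dens R S (q, w) g1.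
  apply: contrapT => nex.
  have dle : dens R S P g1 <= \sum_(w <- Z) dens R S (q, w) g1.
    rewrite /dens -mulr_sumr ler_wpM2l ?(ltW (vol_gt0 _ _ _)) //.
    rewrite -natr_sum ler_nat.
    under [leqRHS]eq_bigr do rewrite -size_filter.
    rewrite -size_flatten_map -size_filter.
    apply: uniq_leq_size; first by rewrite filter_uniq ?desc_uniq.
    move=> z; rewrite mem_filter => /andP[Sz _].
    have [oz bz lz] := S_loc g1 z q qg1 Sz.
    apply/flattenP; exists [seq z0 <- desc (g1 - q) (anc (g1 - q) z) | S (g1,
      z0)].
      apply: (map_f (fun w => [seq z0 <- desc (g1 - q) w | S (g1, z0)])).
      by rewrite -lz; exact: HZ.
    by rewrite mem_filter Sz mem_desc eqxx.
  have := lt_le_trans (Tg g1 (leq_maxl _ _)) dle; rewrite ltNge => /negP; apply.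
  apply: (@le_trans _ _ (\sum_(w <- Z) T / 4 ^+ n)).
    rewrite big_seq [leRHS]big_seq; apply: ler_sum => w wZ; rewrite leNgt.
    by apply/negP => Tw; apply: nex; exists w.
  by rewrite big_const_seq count_predT iter_addr_0 szZ -[leLHS]mulr_natr natrX
    divfK ?expf_neq0 ?lexx.
have [z zQ Sz] : exists2 z, z \in desc (g1 - q) w & S (g1, z).
  have : 0 < dens R S (q, w) g1 by apply: lt_trans Tw;
    rewrite divr_gt0 ?exprn_gt0.
  rewrite /dens pmulr_rgt0 ?vol_gt0 // ltr0n -has_count => /hasP[z zQ Sz].
  by exists z.
have zqw : below (g1, z) (q, w) by rewrite belowE qg1.
have bP : below (q, w) P.
  have Pg1 : (P.1 <= g1)%N by exact: leq_trans Pq qg1.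
  have [oz bz lz] := S_loc g1 z P.1 Pg1 Sz.
  have zP : below (g1, z) P by rewrite /below Pg1 /= -lz (ballP _ bz).2.
  exact: below_cmp zP zqw Pq.
exists (q, w); split => //=.
- by rewrite rq qr.
- have [oz bz lz] := S_loc g1 z q qg1 Sz.
  by exists (corner o (g1, z)) => //; rewrite lz; apply/eqP; rewrite -mem_desc.
move=> j0 j0j; exists g1 => //.
move=> g' gg' A AQ AO.
have qg' : (q <= g')%N by exact: leq_trans gg'.
have Tg' : T / 4 ^+ n < dens R S (q, w) g'.
  by apply: lt_le_trans Tw _; apply: dens_le => //=; rewrite qg1.
pose X (B : cub) := [seq y <- desc (g' - q) w | S (g', y) && below (g', y) B].
have dle : dens R S (q, w) g' <= lsp_const * u `^ (n%:R - s) * \sum_(B <- A) cst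
  B.1.
  apply: (@le_trans _ _ (\sum_(B <- A) vol g' * (size (X B))%:R)).
    rewrite -mulr_sumr ler_wpM2l ?(ltW (vol_gt0 _ _ _)) // -natr_sum ler_nat.
    rewrite -size_flatten_map -size_filter.
    apply: uniq_leq_size; first by rewrite filter_uniq ?desc_uniq.
    move=> y; rewrite mem_filter => /andP[Sy yQ].
    have /hasP[B BA yB] : has (below (g', y)) A.
      apply: AO; first by rewrite belowE qg'.
      move: Sy => /asboolP Sy; apply/asboolP => v /Sy[_ Fv].
      by exists j.
    apply/flattenP; exists (X B); first exact: map_f.
    by rewrite mem_filter Sy yB.
  rewrite mulr_sumr big_seq [leRHS]big_seq; apply: ler_sum => B BA.
  apply: (@lsp_count_le _ j) => //.
  - apply: lt_trans rr1; rewrite ltr_pM2l //; apply: le_lt_trans qr.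
    by apply: ell_ge; exact: below_gen (AQ B BA).
  - by rewrite filter_uniq ?desc_uniq.
  - move=> y; rewrite mem_filter => /andP[/andP[/asboolP Sy yB] _].
    by split => // v /Sy[].
set Sig := \sum_(B <- A) _ in dle *.
set W := u `^ (n%:R - s) in dle.
have W0 : 0 < W by rewrite powR_gt0.
set th := theta `^ _.
have th0 : 0 < th by rewrite powR_gt0.
have TE : T = c3 * W * th * r ^+ n / (2 * n.+1%:R ^+ n).
  rewrite /T; congr (_ / _).
  have -> : u `^ (n%:R - k) = W * u `^ (s - k).
    by rewrite -powRD ?(gt_eqF u0) ?implybT //; congr (_ `^ _); ring.
  have rn : r ^+ n = r `^ (n%:R - k) * r `^ k.
    rewrite -powR_mulrn ?(ltW r0) // -powRD ?(gt_eqF r0) ?implybT //.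
    by congr (_ `^ _); ring.
  have rt : (r / theta) `^ (n%:R - k) = r `^ (n%:R - k) * th.
    rewrite powRM ?invr_ge0 ?(ltW r0) ?(ltW theta0) //.
    by rewrite -powR_inv1 ?(ltW theta0) // -powRrM mulN1r.
  by rewrite uE rt rn; ring.
have volq : vol q <= 2 ^+ n * r ^+ n.
  by rewrite ell_vol -exprMn ler_pXn2r ?nnegrE ?mulr_ge0 ?(ltW (ell_gt0 _ _))
    ?(ltW r0) ?(ltW qr).
have C0 := lsp_const_gt0.
rewrite -(ler_pM2l (mulr_gt0 C0 W0)).
apply: le_trans dle; apply: le_trans (ltW Tg'); rewrite TE.
have N0 : 0 < n.+1%:R ^+ n :> R by rewrite exprn_gt0.
have F0 : 0 < 4 ^+ n :> R by rewrite exprn_gt0.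
have T0' : 0 < 2 ^+ n :> R by rewrite exprn_gt0.
have -> : c3 * W * th * r ^+ n / (2 * n.+1%:R ^+ n) / 4 ^+ n =
    lsp_const * W * (rich_const * th * (2 ^+ n * r ^+ n)).
  rewrite /rich_const; field.
  by rewrite !gt_eqF.
by rewrite ler_pM2l ?mulr_gt0 // ler_pM2l // mulr_gt0 // rich_const_gt0.
Qed.

End LSP.

(** * Full content of the shrunk neighbourhoods *)

Lemma powR_lt_eventually (R : realType) (Upsilon : nat -> R) (a theta e : R) :
  0 < a < 1 -> 0 < theta -> 0 < e ->
  (forall j, 0 <= Upsilon j) -> Upsilon j @[j --> \oo] --> (0 : R) ->
  exists J, forall j, (J <= j)%N -> 0 < Upsilon j ->
    Upsilon j < theta * Upsilon j `^ a /\ Upsilon j `^ a < e.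
Proof.
move=> /andP[a0 a1] th0 e0 U0 Ucvg.
have a1' : 0 < 1 - a by rewrite subr_gt0.
(* The first bound makes U^(1-a) < theta, that is U < theta U^a; the second makes U^a < e. *)
pose eta := Num.min (theta `^ (1 - a)^-1) (e `^ a^-1).
have eta0 : 0 < eta by rewrite lt_min !powR_gt0.
have /cvgrPdist_lt/(_ eta eta0)[J _ HJ] := Ucvg.
exists J => j Jj u0; have := HJ j Jj; rewrite sub0r normrN ger0_norm ?U0 //.
rewrite lt_min => /andP[ut ue]; split; last first.
  have := gt0_ltr_powR a0 (U0 j) (powR_ge0 _ _) ue.
  by rewrite -powRrM mulVf ?gt_eqF // powRr1 // ltW.
have := gt0_ltr_powR a1' (U0 j) (powR_ge0 _ _) ut.
rewrite -powRrM mulVf ?gt_eqF // powRr1 ?(ltW th0) // => h.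
have E : Upsilon j = Upsilon j `^ (1 - a) * Upsilon j `^ a.
  by rewrite -{1}(powRr1 (U0 j)) -powRD ?(gt_eqF u0) ?implybT //;
    congr (_ `^ _); ring.
by rewrite [ltLHS]E ltr_pM2r ?powR_gt0.
Qed.

Section Full.
Context (R : realType) (n : nat) (o : 'rV[R]_n).
Context (F : nat -> set 'rV[R]_n) (Upsilon : nat -> R) (k s a c3 c4 r1 : R).
Hypotheses (n_gt0 : (0 < n)%N) (k_lt_s : k < s) (s_lt_n : s < n%:R).
Hypotheses (c3_gt0 : 0 < c3) (c4_gt0 : 0 < c4) (r1_gt0 : 0 < r1).
Hypothesis lsp_ge : forall (r delta : R) j x, 0 < r -> r < r1 ->
  0 <= delta -> delta < r -> F j x ->
  ((c3 * (delta `^ (n%:R - k) * r `^ k))%:E <=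
   hausdorff_measure n%:R (eucl_ball x r `&` nbhd_set (F j) delta))%E.
Hypothesis lsp_le : forall (r delta : R) j x, 0 < r -> r < r1 ->
  0 <= delta -> delta < r -> F j x ->
  (hausdorff_measure n%:R (eucl_ball x r `&` nbhd_set (F j) delta)
    <= (c4 * (delta `^ (n%:R - k) * r `^ k))%:E)%E.
Hypotheses (U_ge0 : forall j, 0 <= Upsilon j)
  (U_cvg : Upsilon j @[j --> \oo] --> (0 : R)).
Hypotheses (a_01 : 0 < a < 1) (aE : a * (n%:R - k) = s - k).
Hypothesis full : forall (x : 'rV[R]_n) (r : R), 0 < r ->
  hausdorff_measure n%:R
    (eucl_ball x r `&` limsup_nbhd F (fun j => Upsilon j `^ a)) =
  hausdorff_measure n%:R (eucl_ball x r).
Local Notation cub := (cub n).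
Local Notation idx := (idx n).
Local Notation ell := (ell R).
Local Notation vol := (vol R n).
Local Notation target := (target o F Upsilon).
Local Notation cst := (cst s).
Local Notation rich_const := (rich_const n k c3 c4).

(* Sets [F j] passing near the central cube have their rich cubes inside [P]. *)
Definition central (P : cub) : cub := (P.1.+2, [ffun i => (P.2 i * 4).+1])%N.

Lemma ell4 q : ell q = 4 * ell q.+2.
Proof. by rewrite -(ellD R q 2) addn2 mulrC. Qed.

Lemma central_near P x y : ccube o (central P) y ->
  eucl_dist x y < ell P.1.+2 -> orthant o x /\ loc o P.1 x = P.2.
Proof.
move=> Py xy; have l0 := ell_gt0 R P.1.+2.
have H i : o ord0 i + (P.2 i)%:R * ell P.1 <= x ord0 i
    < o ord0 i + (P.2 i).+1%:R * ell P.1.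
  have /andP[] := Py i; rewrite /= ffunE.
  have := le_lt_trans (coord_le_eucl_dist x y i) xy;
    rewrite ltr_norml (ell4 P.1).
  rewrite -[(_ * 4).+2%:R]natr1 -[(_ * 4).+1%:R]natr1 natrM -[(P.2
    i).+1%:R]natr1.
  set z := (P.2 i)%:R; set l := ell P.1.+2 in l0 *; set X := x _ _;
    set Y := y _ _.
  move=> /andP[h1 h2] h3 h4; apply/andP; split; lra.
split; last exact: loc_eq.
move=> i; have /andP[+ _] := H i; apply: le_trans.
by rewrite lerDl mulr_ge0 // ltW // ell_gt0.
Qed.

Definition mid (P : cub) : 'rV[R]_n :=
  \row_i (o ord0 i + (P.2 i)%:R * ell P.1 + ell P.1 / 2).

Lemma mid_ball P y : eucl_ball (mid P) (ell P.1 / 2) y ->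
  orthant o y /\ loc o P.1 y = P.2.
Proof.
move=> Py; have l0 := ell_gt0 R P.1.
have H i : o ord0 i + (P.2 i)%:R * ell P.1 <= y ord0 i
    < o ord0 i + (P.2 i).+1%:R * ell P.1.
  have := le_lt_trans (coord_le_eucl_dist (mid P) y i) Py.
  rewrite ltr_norml mxE -[(P.2 i).+1%:R]natr1 mulrDl mul1r => /andP[h1 h2].
  apply/andP; split; lra.
split; last exact: loc_eq.
move=> i; have /andP[+ _] := H i; apply: le_trans.
by rewrite lerDl mulr_ge0 // ltW.
Qed.

(** The cell of the midpoint [n.+1] generations below [P] fits into the ball of radius half the
    side, as [n.+1 <= 2 ^ n]; the second factor is its share of the volume, the first the loss in
    [hausdorff_measure_ge_cubes]. *)
Definition ball_const : R := (8 ^+ n)^-1 * (2 ^+ (n.+1 * n))^-1.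

Lemma ball_const_gt0 : 0 < ball_const.
Proof. by rewrite mulr_gt0 ?invr_gt0 ?exprn_gt0. Qed.

Lemma mid_ball_measure P :
  ((ball_const * vol P.1)%:E <=
    hausdorff_measure n%:R (eucl_ball (mid P) (ell P.1 / 2)))%E.
Proof.
have omid : orthant o (mid P).
  by move=> i; rewrite mxE -addrA lerDl addr_ge0 ?mulr_ge0 ?invr_ge0 ?(ltW
    (ell_gt0 _ _)).
pose m := (P.1 + n.+1)%N.
have -> : ball_const * vol P.1 =
    (8 ^+ n)^-1 * (vol m * (size [:: loc o m (mid P)])%:R).
  rewrite mulr1 -(volD R n P.1 n.+1) /ball_const natrX -/m -mulrA;
    congr (_ * _).
  by rewrite mulrC mulfK // expf_neq0.
apply: (hausdorff_measure_ge_cubes (o := o)) => // z; rewrite inE => /eqP ->.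
apply: ccube_sub_ball => //; rewrite ler_pdivlMr // -(ellD R P.1 n.+1) -/m.
rewrite mulrAC mulrC ler_pM2l ?ell_gt0 // -natrM ler_nat expnSr leq_mul2r /=.
exact: ltn_expl.
Qed.

(** By full measure, small cells inside the neighbourhoods Delta(F_j,R_j) fill a fixed share of the
    central cube. Each has a rich cube of side about theta R_j at distance of order R_j, so
    [vitali_count] applies with [K] of order 1/theta. The proportion [f] depends on theta but not on
    [P], which allows iteration. *)
Lemma rich_fraction (theta : R) (j0 : nat) :
  0 < theta -> theta <= 1 ->
  let D := rich_const * theta `^ (- (n%:R - k)) in
  let rich : pred cub := fun Q => `[< cap cst (target j0) Q (D * vol Q.1) >] in
  exists f : R, 0 < f /\ forall P : cub, exists h,
    f * (2 ^ (h * n))%:R <= (count (mark rich (P.1 + h) P) (desc h P.2))%:R.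
Proof.
move=> th0 th1 D rich.
(* The corner of a cell and some point of its rich cube are at distance less than R_j + r = (1 +
   1/theta) r, where r = theta R_j is at most the side of that cube. The further unit in [K] is the
   one in [loc_ge]. *)
pose K0 := (Num.truncn (1 + theta^-1)).+1.
have K0P : 1 + theta^-1 <= K0%:R by apply/ltW; exact: truncnS_gt.
pose K := K0.+1.
(* The factor [4 ^+ n] compares [P] with its central cube; the last denominator is the loss in
   [dens_gt], doubled for strictness. *)
pose c0 : R := ball_const * (4 ^+ n)^-1 / (2 * n.+1%:R ^+ n).
have c00 : 0 < c0 by rewrite divr_gt0 ?mulr_gt0 ?invr_gt0 ?exprn_gt0
  ?ball_const_gt0.
pose f := c0 / ((K.*2.+1) ^ n)%:R.
have N0 : 0 < ((K.*2.+1) ^ n)%:R :> R by rewrite ltr0n expn_gt0.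
exists f; split; first by rewrite divr_gt0.
move=> P; set P' := central P.
have l0 := ell_gt0 R P.1.+2.
(* Bounds for R_j: the first two allow [rich_cube] to be applied, the last keeps B(x,r) so near the
   central cube that it stays in [P]. *)
pose e := Num.min (Num.min 1 (r1 / (n.+1%:R * 2))) (ell P.1.+2 / 2).
have e0 : 0 < e by rewrite !lt_min ltr01 !divr_gt0.
have [J HJ] := powR_lt_eventually a_01 th0 e0 U_ge0 U_cvg.
have a_neq0 : a != 0 by case/andP: a_01 => /gt_eqF ->.
(* The bound on the side ensures that a cell is no larger than its rich cube, as [vitali_count]
   requires. *)
pose S : pred cub := fun C => `[< exists j, [/\ (maxn J j0 <= j)%N, 0 < Upsilon
  j,
  ccube o C `<=` nbhd_set (F j) (Upsilon j `^ a) & ell C.1 <= theta * Upsilon j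
    `^ a] >].
have hS : hereditary S.
  move=> A B AB /asboolP[j [Jj Uj Bj lj]]; apply/asboolP; exists j; split => //.
    exact: subset_trans (ccube_below AB) Bj.
  by apply: le_trans lj; apply: ell_ge; exact: below_gen AB.
have [m P'm Tm] : exists2 m, (P'.1 <= m)%N & c0 * vol P.1 < dens R S P' m.
  apply: (dens_gt (o := o) (E := eucl_ball (mid P') (ell P'.1 / 2) `&`
    limsup_nbhd F (fun j => Upsilon j `^ a))) => //.
    move=> y [/mid_ball[oy yP] Ly]; split => //.
    have [j Jj Fy] : exists2 j, (maxn J j0 <= j)%N & nbhd_set (F j) (Upsilon j
      `^ a) y.
      have [j [Fy Jj]] := infinite_setN0 (infinite_setD Ly (finite_II (maxn J
        j0))).
      by exists j => //; rewrite leqNgt; exact/negP.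
    (* If [Upsilon j] were 0, so would be its power, since [a] is nonzero, and the neighbourhood
       would be empty. *)
    have Uj : 0 < Upsilon j.
      rewrite lt_neqAle U_ge0 andbT; apply/eqP => U0; move: Fy;
        rewrite -U0 powR0 //.
      by move=> /nbhd_setP[x _]; rewrite ltNge eucl_dist_ge0.
    have [e1 e10 He1] := nbhd_set_sub Fy.
    have [q Hq] := ell_small (mulr_gt0 th0 (powR_gt0 a Uj)).
    have [m mm Hm] := ccube_in_ball (maxn P'.1 q) e10 oy.
    move: mm; rewrite geq_max => /andP[Pm qm].
    exists m => //; apply/asboolP; exists j; split => //.
      exact: subset_trans Hm He1.
    exact: ltW (Hq m qm).
  rewrite full ?divr_gt0 ?ell_gt0 //.
  apply: lt_le_trans (mid_ball_measure P'); rewrite lte_fin.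
  have -> : ball_const * vol P'.1 = 2 * (n.+1%:R ^+ n * (c0 * vol P.1)).
    have M0 : n.+1%:R ^+ n != 0 :> R by rewrite expf_neq0.
    have M4 : 4 ^+ n != 0 :> R by rewrite expf_neq0.
    have E4 : (2 ^ (2 * n))%:R = 4 ^+ n :> R by rewrite expnM natrX.
    rewrite -(volD R n P.1 2) addn2 E4 /c0 /=.
    move: M0 M4; set x := _.+1%:R ^+ n; set y := 4 ^+ n => *; field.
    by apply/andP; split.
  have : 0 < n.+1%:R ^+ n * (c0 * vol P.1) by rewrite !mulr_gt0 ?exprn_gt0
    ?vol_gt0.
  lra.
have Pm : (P.1 <= m)%N by apply: leq_trans P'm; rewrite /= -addn2 leq_addr.
pose Z := [seq z <- desc (m - P'.1) P'.2 | S (m, z)].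
have sizeZ : dens R S P' m = vol m * (size Z)%:R by rewrite /dens size_filter.
have cZ : (size Z <= (K.*2.+1) ^ n * count (mark rich m P) (desc (m - P.1)
  P.2))%N.
  apply: vitali_count; first by rewrite filter_uniq ?desc_uniq.
  move=> z; rewrite mem_filter => /andP[/asboolP[j [Jj Uj Fj lj]] zP'].
  have zb : below (m, z) P' by rewrite belowE P'm.
  set y := corner o (m, z).
  have yP' : ccube o P' y by apply: (ccube_below zb); exact: ccube_corner.
  have /nbhd_setP[x Fx yx] := Fj _ (ccube_corner o (m, z)).
  move: Jj; rewrite geq_max => /andP[/HJ/(_ Uj)[ur Re] j0j].
  move: Re; rewrite !lt_min => /andP[/andP[R1 Rr1] Rl].
  pose Ra := Upsilon j `^ a; pose r := theta * Ra.
  rewrite -/Ra in R1 Rr1 Rl yx ur lj; rewrite -/r in ur lj.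
  have Ra0 : 0 < Ra by rewrite powR_gt0.
  have rRa : r <= Ra by rewrite /r ler_piMl // ltW.
  have ll := ell4 P.1.
  have [|||||Q [QP /andP[rQ Qr] [v xv vQ] capQ]] :=
    @rich_cube R n o F Upsilon k s c3 c4 r1 n_gt0 k_lt_s s_lt_n c3_gt0 c4_gt0
      lsp_ge lsp_le j x theta r P th0 Fx Uj ur.
  - by rewrite /r mulrAC divff ?gt_eqF // mul1r -powRrM aE.
  - by apply: le_trans rRa _; exact: ltW.
  - by rewrite mulrA -ltr_pdivlMl ?mulr_gt0 // mulrC (le_lt_trans rRa).
  - by rewrite ll; lra.
  - move=> w xw; apply: (central_near yP').
    have := eucl_distD y x w; rewrite /eucl_ball /= in xw.
    by rewrite eucl_distC; lra.
  have Qm : (Q.1 <= m)%N.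
    rewrite leqNgt; apply/negP => mQ.
    have : ell Q.1 <= ell m.+1 by exact: ell_ge.
    have := ellD R m 1; rewrite addn1 expn1 => h.
    have := ell_gt0 R m.+1; have := le_trans lj rQ; rewrite /=; lra.
  exists Q; split => //; first by apply/asboolP; exact: capQ.
  have yv i : `|y ord0 i - v ord0 i| <= K0%:R * ell Q.1.
    apply: le_trans (coord_le_eucl_dist y v i) _;
      apply: le_trans (eucl_distD y x v) _.
    apply: (@le_trans _ _ ((1 + theta^-1) * r)).
      rewrite /eucl_ball /= in xv.
      by rewrite mulrDl mul1r /r mulrA mulVf ?gt_eqF // mul1r addrC ltW // ltrD.
    apply: ler_pM => //; first by rewrite addr_ge0 // invr_ge0 ltW.
    by rewrite /r mulr_ge0 ?powR_ge0 ?(ltW th0).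
  have -> : anc (m - Q.1) z = loc o Q.1 y by rewrite (loc_corner_le o (C := (m,
    z))).
  rewrite -vQ => i; split; first exact: loc_ge.
  by apply: loc_ge; rewrite distrC.
exists (m - P.1)%N; rewrite subnKC //.
rewrite /f mulrAC ler_pdivrMr //.
apply: (@le_trans _ _ (size Z)%:R); last by rewrite mulrC -natrM ler_nat.
rewrite -(ler_pM2l (vol_gt0 R n m)) -sizeZ.
have -> : vol m * (c0 * (2 ^ ((m - P.1) * n))%:R) = c0 * vol P.1.
  by rewrite mulrCA -{1}(subnKC Pm) volD.
exact: ltW.
Qed.

(** Full content of [P] means content [e] per unit volume. A small theta makes [D] at least twice
    [e]; at fine generations content [D] per unit volume is affordable, so [cap_half] yields half of
    it there, and [cap_up] carries [e] up to [P]. *)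
Lemma cap_full (j0 : nat) (P : cub) : cap cst (target j0) P (cst P.1).
Proof.
have ns0 : 0 < n%:R - s by rewrite subr_gt0.
have nk0 : 0 < n%:R - k by rewrite subr_gt0 (lt_trans k_lt_s).
have rc0 : 0 < rich_const by exact: rich_const_gt0.
have vP0 := vol_gt0 R n P.1; have cP0 := cst_gt0 s P.1.
pose e := cst P.1 / vol P.1.
have e0 : 0 < e by exact: divr_gt0.
pose theta := Num.min 1 ((rich_const / (2 * e)) `^ (n%:R - k)^-1).
have rce0 : 0 < rich_const / (2 * e).
  by apply: divr_gt0 => //; exact: mulr_gt0.
have th0 : 0 < theta by rewrite lt_min ltr01 powR_gt0.
have th1 : theta <= 1 by rewrite ge_min lexx.
pose D := rich_const * theta `^ (- (n%:R - k)).
have D0 : 0 < D by rewrite mulr_gt0 ?powR_gt0.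
have De : e <= 2^-1 * D.
  have h : theta `^ (n%:R - k) <= rich_const / (2 * e).
    have -> : rich_const / (2 * e) =
        ((rich_const / (2 * e)) `^ (n%:R - k)^-1) `^ (n%:R - k).
      by rewrite -powRrM mulVf ?gt_eqF // powRr1 // ltW.
    apply: ge0_ler_powR; rewrite ?nnegrE ?powR_ge0 ?(ltW th0) ?(ltW nk0) //.
    by rewrite ge_min lexx orbT.
  rewrite /D powRN; move: h; have : 0 < theta `^ (n%:R - k) by rewrite powR_gt0.
  have e2 : 0 < 2 * e by exact: mulr_gt0.
  set t := theta `^ _ => t0; rewrite (ler_pdivlMr _ _ e2) => h.
  by rewrite mulrA (ler_pdivlMr _ _ t0); lra.
have [q0 Hq0] := ell_small (powR_gt0 (n%:R - s)^-1 (divr_gt0 ltr01 D0)).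
pose p0 := maxn q0 P.1.
have Dc q : (p0 <= q)%N -> D * vol q <= cst q.
  rewrite geq_max => /andP[/Hq0 qD _].
  rewrite (vol_cst _ s) mulrCA ger_pMr ?cst_gt0 // mulrC -ler_pdivlMr //.
  have -> : 1 / D = ((1 / D) `^ (n%:R - s)^-1) `^ (n%:R - s).
    by rewrite -powRrM mulVf ?gt_eqF // powRr1 // divr_ge0 ?ltW.
  apply: ge0_ler_powR; rewrite ?nnegrE ?powR_ge0 ?(ltW ns0) ?(ltW qD) //.
  exact/ltW/ell_gt0.
have [f [f0 Hf]] := rich_fraction j0 th0 th1.
have half : forall Q : cub, (p0 <= Q.1)%N ->
    cap cst (target j0) Q (2^-1 * D * vol Q.1).
  apply: (cap_half (cst_ge0 s) (rich := fun Q => `[< cap cst (target j0) Q (D *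
    vol Q.1) >])
    _ _ _ (f := Num.min f 1)).
  - exact: ltW.
  - exact: Dc.
  - by move=> Q /asboolP.
  - by rewrite lt_min f0 ltr01.
  - by rewrite ge_min lexx orbT.
  move=> Q _; have [h Hh] := Hf Q; exists h; apply: le_trans Hh.
  by rewrite ler_wpM2r // ge_min lexx.
have -> : cst P.1 = e * vol P.1 by rewrite divfK ?gt_eqF.
apply: (cap_up (cst_ge0 s) (k := p0 - P.1)).
- exact: ltW.
- have lP0 : 0 < ell P.1 `^ (n%:R - s) by rewrite powR_gt0 // ell_gt0.
  have eE : e * ell P.1 `^ (n%:R - s) = 1.
    by rewrite /e (vol_cst _ s) invfM mulrA divff ?gt_eqF // mul1r mulVf
      ?gt_eqF.
  move=> q Pq; rewrite (vol_cst _ s) mulrCA ger_pMr ?cst_gt0 // -[leRHS]eE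
    ler_pM2l //.
  apply: ge0_ler_powR; rewrite ?nnegrE ?(ltW ns0) ?(ltW (ell_gt0 _ _)) //.
  exact: ell_ge.
- move=> Q QE; apply: cap_le (half Q _).
    by rewrite ler_wpM2r ?(ltW (vol_gt0 _ _ _)).
  by rewrite QE subnKC // leq_maxr.
Qed.

End Full.

(** * The three ranges of the exponent *)

Lemma infinite_set_nat (A : set nat) :
  (forall N, exists2 j, (N <= j)%N & A j) -> infinite_set A.
Proof.
move=> HA /finite_seqP[l lE]; have [j jl Aj] := HA (\max_(i <- l) i).+1.
have : j \in l by move: Aj; rewrite lE.
by move=> jl'; move: jl; rewrite (big_rem j) //= ltnNge leq_maxl.
Qed.

Section LargeExponent.
Context (R : realType) (n : nat).

Lemma hausdorff_measure_ge0 (s : R) (E : set 'rV[R]_n) :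
  (0 <= hausdorff_measure s E)%E.
Proof.
apply: le_trans (hausdorff_content_le s E ltr01).
apply: le_ereal_inf_tmp => _ [D [c [r [_ ->]]]]; apply: esum_ge0 => i _.
by rewrite lee_fin powR_ge0.
Qed.

Lemma ell_powR_small (t e : R) : 0 < t -> 0 < e ->
  exists q0, forall q, (q0 <= q)%N -> ell R q `^ t < e.
Proof.
move=> t0 e0; have [q0 Hq0] := ell_small (powR_gt0 t^-1 e0).
exists q0 => q /Hq0 h.
have := gt0_ltr_powR t0 (ltW (ell_gt0 R q)) (powR_ge0 _ _) h.
by rewrite -powRrM mulVf ?gt_eqF // powRr1 // ltW.
Qed.

(** About 2^(mn) cells of generation m cover the ball, each at a cost of order 2^(-ms), and the
    total tends to 0. *)
Lemma hausdorff_measure_ball0 (s : R) (x : 'rV[R]_n) (r : R) :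
  n%:R < s -> 0 < r -> hausdorff_measure s (eucl_ball x r) = 0%E.
Proof.
move=> ns r0; apply/eqP; rewrite eq_le hausdorff_measure_ge0 andbT.
apply: hausdorff_measure_le => rho rho0.
apply/lee_addgt0Pr => e e0; rewrite add0e.
(* This origin puts the whole ball into the orthant. *)
pose o : 'rV[R]_n := \row_i (x ord0 i - r).
pose N := (Num.truncn (2 * r)).+1.
pose Z0 : seq (idx n) := [seq [ffun i => nat_of_ord (v i)] | v : {ffun 'I_n ->
  'I_N}].
have n1 : 0 < n.+1%:R :> R by [].
have b0 : 0 < (size Z0)%:R * n.+1%:R `^ s + 1 by rewrite ltr_wpDl // mulr_ge0
  ?powR_ge0.
have sn : 0 < s - n%:R by rewrite subr_gt0.
have [q1 H1] := ell_powR_small sn (divr_gt0 e0 b0).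
have [q2 H2] := ell_small (divr_gt0 rho0 n1).
pose m := maxn q1 q2.
apply: (hausdorff_content_cubes (o := o)
  (T := [set C | C.1 = m /\ anc m C.2 \in Z0])).
- move=> y xy.
  have H i : - r < x ord0 i - y ord0 i < r.
    by have := le_lt_trans (coord_le_eucl_dist x y i) xy; rewrite ltr_norml.
  have oy : orthant o y by move=> i; rewrite mxE; have /andP[h1 h2] := H i; lra.
  split => //; exists m; split => //=.
  have := anc_loc 0 m oy; rewrite add0n => ->; apply/mapP.
  have lN i : (loc o 0 y i < N)%N.
    rewrite ffunE /N ltnS; apply: le_truncn.
    rewrite /ell expr0 divr1 mxE; have /andP[h1 h2] := H i; lra.
  exists [ffun i => Ordinal (lN i)]; first by rewrite mem_enum.
  by apply/ffunP => i; rewrite [RHS]ffunE [in RHS]ffunE.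
- by move=> C [-> _]; rewrite mulrC -ltr_pdivlMr // H2 // leq_maxr.
move=> l ul lT.
have sl : (size l <= size Z0 * 2 ^ (m * n))%N.
  have -> : (size Z0 * 2 ^ (m * n) = size (flatten [seq desc m z | z <- Z0]))%N.
    rewrite size_flatten_map; under eq_bigr do rewrite size_desc.
    by rewrite big_const_seq count_predT iter_addn_0 mulnC.
  rewrite -(size_map snd l); apply: uniq_leq_size.
    rewrite map_inj_in_uniq // => -[q z] [q' z'] /lT[/= -> _] /lT[/= -> _] ->.
    by [].
  move=> _ /mapP[C /lT[_ CZ] ->]; apply/flattenP.
  by exists (desc m (anc m C.2)); [exact: map_f|rewrite mem_desc].
have l0 := ell_gt0 R m.
rewrite big_seq (eq_bigr (fun=> n.+1%:R `^ s * (ell R m `^ (s - n%:R) * vol R n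
  m))); last first.
  move=> C /lT[-> _]; rewrite powRM ?(ltW l0) //; congr (_ * _).
  rewrite ell_vol -powR_mulrn ?(ltW l0) // -powRD ?(gt_eqF l0) ?implybT //.
  by congr (_ `^ _); ring.
rewrite -big_seq big_const_seq count_predT iter_addr_0 -[leLHS]mulr_natr.
have v0 := vol_gt0 R n m.
apply: (@le_trans _ _ (n.+1%:R `^ s * (ell R m `^ (s - n%:R) * vol R n m) *
    ((size Z0)%:R * (2 ^ (m * n))%:R))).
  by rewrite ler_wpM2l ?mulr_ge0 ?powR_ge0 ?(ltW v0) // -natrM ler_nat.
have vE : vol R n m * (2 ^ (m * n))%:R = 1 by rewrite -{1}(add0n m) volD /vol
  mul0n expr0.
have -> : n.+1%:R `^ s * (ell R m `^ (s - n%:R) * vol R n m) *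
    ((size Z0)%:R * (2 ^ (m * n))%:R) =
  (size Z0)%:R * n.+1%:R `^ s * ell R m `^ (s - n%:R) * (vol R n m * (2 ^ (m *
    n))%:R).
  by ring.
rewrite vE mulr1; have := H1 m (leq_maxl _ _); rewrite (ltr_pdivlMr _ _ b0).
by have := powR_ge0 (ell R m) (s - n%:R); lra.
Qed.

End LargeExponent.

Section SmallExponent.
Context (R : realType) (n : nat) (s : R).
Context (F : nat -> set 'rV[R]_n) (Upsilon : nat -> R).
Hypotheses (s_gt0 : 0 < s) (s_lt_n : s < n%:R).

(** The tree of [cap_full_tree] for the targets [N = 0, 1, ...] gives nested compact sets whose
    intersection lies in the ball and meets, for every N, some Delta(F_j,Upsilon_j) with j >= N at
    each of its points. The cost bound of the tree grows without limit with [h], because [s < n]. *)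
Lemma hausdorff_measure_limsup_oo (x : 'rV[R]_n) (r : R) : 0 < r ->
  (forall j0 P, cap (cst s) (target x F Upsilon j0) P (cst s P.1)) ->
  hausdorff_measure s (eucl_ball x r `&` limsup_nbhd F Upsilon) = +oo%E.
Proof.
move=> r0 full; apply/eqyP => M M0.
have n1 : 0 < n.+1%:R :> R by [].
have ns0 : 0 < n%:R - s by rewrite subr_gt0.
have [p0 Hp0] := ell_small (divr_gt0 r0 n1).
pose P0 : cub n := (p0, [ffun=> 0%N]).
have P0x : ccube x P0 `<=` eucl_ball x r.
  have -> : P0 = (p0, loc x p0 x).
    by congr (_, _); apply/ffunP => i; rewrite !ffunE subrr mul0r truncn0.
  apply: ccube_sub_ball; last by move=> i.
  by rewrite mulrC -ler_pdivlMr // ltW // Hp0.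
pose C : R := 4 ^+ n * 2 `^ s.
have C0 : 0 < C by rewrite mulr_gt0 ?exprn_gt0 ?powR_gt0.
have CM0 : 0 < C * M by exact: mulr_gt0.
have [h Hh] : exists h, C * M <= (2 ^ (h * n))%:R * cst s (p0 + h).
  have [h Hh] := ell_powR_small ns0 (divr_gt0 (vol_gt0 R n p0) CM0).
  exists h; have := Hh (p0 + h)%N (leq_addl _ _).
  rewrite (ltr_pdivlMr _ _ CM0) -(volD R n p0 h) (vol_cst _ s).
  set E := ell R _ `^ _; have E0 : 0 < E by rewrite powR_gt0 // ell_gt0.
  rewrite (_ : _ * E * _ = E * ((2 ^ (h * n))%:R * cst s (p0 + h)));
    last by ring.
  by rewrite (ltr_pM2l E0) => /ltW.
have [g [X [g0 X0 gS XS cost]]] :=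
  cap_full_tree (cst_ge0 s) (O := target x F Upsilon) P0 h full.
pose K N := cubes_union x (g N) (X N).
have KS N : K N.+1 `<=` K N.
  move=> y [z zX zy]; have [_ aX] := XS N z zX.
  exists (anc (g N.+1 - g N) z) => //; apply: (ccube_below _ zy).
  by rewrite /below /= eqxx andbT ltnW.
have Kle N N' : (N <= N')%N -> K N' `<=` K N.
  move=> /subnKC <-; elim: (N' - N)%N => [|i IH]; first by rewrite addn0.
  by rewrite addnS; exact: subset_trans (KS _) IH.
have K0P : K 0 `<=` ccube x P0.
  move=> y [z]; rewrite X0 g0 => zX; apply: ccube_below.
  by rewrite belowE /= leq_addr addKn.
have KE : \bigcap_N K N `<=` eucl_ball x r `&` limsup_nbhd F Upsilon.
  move=> y Ky; split; first by apply/P0x/K0P/Ky.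
  apply: infinite_set_nat => N; have [z zX zy] := Ky N.+1 I.
  by have [/asboolP/(_ _ zy)[j Nj Fj] _] := XS N z zX; exists j.
have gN N : (N <= g N)%N.
  by elim: N => // N IH; exact: leq_ltn_trans IH (gS N).
(* Balls of radius below [rho] become cubes of side less than [2 * rho], the side at generation
   [g 0], as the cost bound of the tree requires. *)
pose rho : R := ell R (g 0) / 2.
have rho0 : 0 < rho by rewrite divr_gt0 ?ell_gt0.
have rho1 : rho <= 1.
  have : ell R (g 0) <= ell R 0 by exact: ell_ge.
  by rewrite /rho {2}/ell expr0; have := ell_gt0 R (g 0); lra.
apply: le_trans (hausdorff_content_le s _ rho0).
apply: le_ereal_inf_tmp => _ [D [c [rr [cov ->]]]].
have [N0 [l [l1 l2 l3]]] := @ball_cover_cubes R n x s rho K _ D c rr s_gt0 rho1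
  (fun N => @cubes_union_compact R n x (g N) (X N)) KS
  (subset_trans K0P (@ccube_orthant _ _ _ _)) KE cov.
pose N := maxn N0 (\max_(A <- l) A.1).
have lN A : A \in l -> (A.1 <= g N)%N.
  move=> Al; apply: leq_trans (gN N); rewrite (leq_trans _ (leq_maxr _ _)) //.
  by rewrite (big_rem A) //= leq_maxl.
have costN : (2 ^ (h * n))%:R * cst s (p0 + h) <= \sum_(A <- l) cst s A.1.
  apply: (cost N).
    move=> A /l1; rewrite /rho mulrC divfK // => Ag; rewrite leqNgt; apply/negP.
    by move=> /ltnW/(ell_ge R); rewrite leNgt Ag.
  move=> z zX; have [|A Al Az] := l2 (corner x (g N, z)).
    apply: (Kle N0 N (leq_maxl _ _)); exists z => //; exact: ccube_corner.
  apply/hasP; exists A => //; rewrite /below lN //= -Az.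
  by rewrite (loc_corner_le x (C := (g N, z))) //= lN.
rewrite -(@lee_pmul2l _ C%:E) ?lte_fin //.
by apply: le_trans l3; rewrite -EFinM lee_fin (le_trans Hh).
Qed.

End SmallExponent.

Theorem corollary1 (R : realType) (n : nat) (hn : (0 < n)%N)
    (kappa : R) (hkappa : 0 <= kappa < 1)
    (F : nat -> set 'rV[R]_n) (hF : local_scaling_property kappa F)
    (Upsilon : nat -> R) (hU0 : forall j, 0 <= Upsilon j)
    (hU : Upsilon j @[j --> \oo] --> (0 : R))
    (s : R) (hs : kappa * n%:R < s)
    (hfull : forall (x : 'rV[R]_n) (r : R), 0 < r ->
       hausdorff_measure n%:R
         (eucl_ball x r `&`
          limsup_nbhd F (fun j =>
            Upsilon j `^ ((s - kappa * n%:R) / ((1 - kappa) * n%:R)))) =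
       hausdorff_measure n%:R (eucl_ball x r)) :
  forall (x : 'rV[R]_n) (r : R), 0 < r ->
    hausdorff_measure s (eucl_ball x r `&` limsup_nbhd F Upsilon) =
    hausdorff_measure s (eucl_ball x r).
Proof.
move=> x r r0; have /andP[k0 k1] := hkappa.
have n0 : 0 < n%:R :> R by rewrite ltr0n.
have nk : 0 < (1 - kappa) * n%:R by rewrite mulr_gt0 // subr_gt0.
have nkE : (1 - kappa) * n%:R = n%:R - kappa * n%:R by rewrite mulrBl mul1r.
(* Below [n] both sides are infinite, above [n] both vanish, and at [n] the exponent in the
   hypothesis is 1, so that the hypothesis is the claim. *)
have [sn|ns|sn] := ltgtP s n%:R.
- have s0 : 0 < s by apply: le_lt_trans hs; rewrite mulr_ge0 // ltW.
  pose a := (s - kappa * n%:R) / ((1 - kappa) * n%:R).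
  have a01 : 0 < a < 1.
    rewrite divr_gt0 ?subr_gt0 //= ltr_pdivrMr // mul1r nkE; lra.
  have aE : a * (n%:R - kappa * n%:R) = s - kappa * n%:R.
    by rewrite -nkE divfK // gt_eqF.
  have [c3 [c4 [r1 [c30 c40 r10 lsp]]]] := hF.
  have lsp_ge (rr d : R) j y : 0 < rr -> rr < r1 -> 0 <= d -> d < rr -> F j y ->
      ((c3 * (d `^ (n%:R - kappa * n%:R) * rr `^ (kappa * n%:R)))%:E <=
       hausdorff_measure n%:R (eucl_ball y rr `&` nbhd_set (F j) d))%E.
    by move=> h1 h2 h3 h4 Fy; have [] := lsp rr d j y h1 h2 h3 h4 Fy.
  have lsp_le (rr d : R) j y : 0 < rr -> rr < r1 -> 0 <= d -> d < rr -> F j y ->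
      (hausdorff_measure n%:R (eucl_ball y rr `&` nbhd_set (F j) d) <=
       (c4 * (d `^ (n%:R - kappa * n%:R) * rr `^ (kappa * n%:R)))%:E)%E.
    by move=> h1 h2 h3 h4 Fy; have [] := lsp rr d j y h1 h2 h3 h4 Fy.
  have H_oo : hausdorff_measure s (eucl_ball x r `&` limsup_nbhd F Upsilon) =
    +oo%E.
    apply: hausdorff_measure_limsup_oo => // j0 P.
    exact: (@cap_full R n x F Upsilon (kappa * n%:R) s a c3 c4 r1).
  rewrite H_oo; apply/esym/eqP; rewrite -leye_eq -H_oo.
  by apply: hausdorff_measure_subset => y [].
- rewrite (hausdorff_measure_ball0 x ns r0); apply/eqP.
  rewrite eq_le hausdorff_measure_ge0 andbT -(hausdorff_measure_ball0 x ns r0).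
  by apply: hausdorff_measure_subset => y [].
- have aE : (s - kappa * n%:R) / ((1 - kappa) * n%:R) = 1.
    by rewrite sn nkE divff // -nkE gt_eqF.
  have := hfull x r r0; rewrite aE -sn.
  by under eq_fun do rewrite powRr1 //.
Qed.
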